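(* Let $X$ and $Y$ be geodesic coarsely convex spaces with nets, and let $X*Y$ be their free product. Then $$\dim (\partial (X*Y)) = \max\{\dim \partial X, \dim \partial Y\},$$ where $\partial$ denotes the ideal boundary and $\dim$ the topological dimension.
   Context: **Geodesic coarsely convex spaces.** A geodesic bicombing on a metric space $(X,d)$ is a map $\gamma:X\times X\times[0,1]\to X$ with $\gamma(x,y,0)=x$, $\gamma(x,y,1)=y$ and $d(\gamma(x,y,t),\gamma(x,y,s))=|t-s|\,d(x,y)$. For constants $E\ge 1$, $C\ge 0$, it is an $(E,C)$-geodesic coarsely convex bicombing if for all $x_1,x_2,y_1,y_2\in X$ and $a,b,c\in[0,1]$, putting $y_1'=\gamma(x_1,y_1,a)$, $y_2'=\gamma(x_2,y_2,b)$, we have $d(\gamma(x_1,y_1,ca),\gamma(x_2,y_2,cb))\le (1-c)E\,d(x_1,x_2)+cE\,d(y_1',y_2')+C$. A geodesic coarsely convex space is a metric space equipped with such a bicombing for some $E,C$. **Ideal boundary.** Let $X$ carry an $(E,C)$-geodesic coarsely convex bicombing $\gamma$ and a base point $e$. Put $\hat\gamma(x,y,t)=\gamma(x,y,t/d(x,y))$ for $0\le t\le d(x,y)$, $x\neq y$, and $\hat\gamma(x,y,t)=y$ otherwise. Set $D=2(1+E)+C$, $D_1=2D+2$, and for $x,y\in X$ let $(x\mid y)_e=\min\{d(e,x),d(e,y),\sup\{t\ge 0: d(\hat\gamma(e,x,t),\hat\gamma(e,y,t))\le D_1\}\}$. Let $S_\infty(X)$ be the set of sequences $(x_i)$ in $X$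 with $(x_i\mid x_j)_e\to\infty$ as $i,j\to\infty$; $(x_i)\sim(y_i)$ iff $(x_i\mid y_i)_e\to\infty$ (an equivalence relation). The ideal boundary is $\partial X=S_\infty(X)/\sim$, and $\overline X=X\cup\partial X$. Extend the product to $\overline X$ by $(x\mid y)=\sup\{\liminf_i (x_i\mid y_i)_e: (x_i)\in x,(y_i)\in y\}$, where for $x\in X$ ''$(x_i)\in x$'' means $x_i=x$ for all $i$. The sets $V_n=\{(x,y)\in\overline X^2:(x\mid y)>n\}\cup\{(x,y)\in X^2:d(x,y)<1/n\}$, $n\in\mathbb{N}$, form a base of a metrizable uniformity on $\overline X$; $\overline X$ has the induced topology and $\partial X$ the subspace topology. **Nets.** A net of a metric space $X$ is a triple $(X_0,i_X,e_X)$ where $X_0$ is a discrete set, $i_X:X_0\to X$ is a proper map and $e_X\in i_X(X_0)$. **Free product.** Let $X,Y$ be metric spaces with nets. Choose $o_X\in X_0$, $o_Y\in Y_0$ with $i_X(o_X)=e_X$, $i_Y(o_Y)=e_Y$; put $X_0^*=X_0\setminus\{o_X\}$, $Y_0^*=Y_0\setminus\{o_Y\}$ (disjoint alphabets). Let $W$ be the set of finite words (including the empty word $\emptyset$) whose letters alternate between $X_0^*$ and $Y_0^*$; let $W_X$ (resp. $W_Y$) be the set of words that are empty or end in a letter of $Y_0^*$ (resp. $X_0^*$). $X*Y$ is obtained from the disjoint union of copies $\{\omega\}\times X$ $(\omega\in W_X)$ and $\{\omega\}\times Y$ $(\omega\in W_Y)$ by attaching, for each $\omega\in W$, one edge of length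 $1$: for $\omega=\emptyset$ joining $(\emptyset,e_X)$ and $(\emptyset,e_Y)$; for $\omega=\omega'x$ with $x\in X_0^*$ joining $(\omega',i_X(x))$ and $(\omega,e_Y)$; for $\omega=\omega'y$ with $y\in Y_0^*$ joining $(\omega',i_Y(y))$ and $(\omega,e_X)$. It carries the induced length metric; the copies and edges are arranged in a tree-like fashion. If $X,Y$ are geodesic coarsely convex, $X*Y$ is equipped with the geodesic bicombing obtained by concatenating the bicombing geodesics in copies of $X$, $Y$ and segments of edges along the unique chain of pieces joining two points, parametrized proportionally to arc length; this is a geodesic coarsely convex bicombing, and $\partial(X*Y)$ is taken with respect to it. **Dimension.** $\dim V$ is the topological (covering) dimension: for an integer $n\ge 0$, $\dim V\le n$ means that every finite open cover of $V$ has a finite open refinement in which every point lies in at most $n+1$ members. *)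

(* Defs.v *)
From HB Require Import structures.
From mathcomp Require Import all_boot all_order all_algebra.
From mathcomp Require Import all_classical all_reals all_analysis.
From mathcomp Require Import ring lra.

Set Implicit Arguments.
Unset Strict Implicit.
Unset Printing Implicit Defensive.

Import Order.TTheory GRing.Theory Num.Theory.
Import numFieldNormedType.Exports numFieldTopology.Exports.

Local Open Scope classical_set_scope.
Local Open Scope card_scope.
Local Open Scope ring_scope.

(* A bicombing is a total function of its last argument, but only its values
   on [0, 1] are constrained or used. *)
Definition geodesic_bicombing (R : realType) (X : metricType R)
    (g : X -> X -> R -> X) : Prop :=
  forall x y, [/\ g x y 0 = x, g x y 1 = y &
    forall t s, 0 <= t <= 1 -> 0 <= s <= 1 ->
      mdist (g x y t) (g x y s) = `|t - s| * mdist x y].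

Definition coarsely_convex (R : realType) (X : metricType R) (E C : R)
    (g : X -> X -> R -> X) : Prop :=
  [/\ 1 <= E, 0 <= C, geodesic_bicombing g &
    forall x1 x2 y1 y2 a b c,
      0 <= a <= 1 -> 0 <= b <= 1 -> 0 <= c <= 1 ->
      mdist (g x1 y1 (c * a)) (g x2 y2 (c * b)) <=
        (1 - c) * E * mdist x1 x2
        + c * E * mdist (g x1 y1 a) (g x2 y2 b) + C].

Section IdealBoundary.
Context {R : realType} {X : metricType R} (E C : R) (g : X -> X -> R -> X)
  (e : X).

Definition hatg (x y : X) (t : R) : X :=
  if (x != y) && (t <= mdist x y) then g x y (t / mdist x y) else y.

Definition bigD : R := 2 * (1 + E) + C.
Definition bigD1 : R := 2 * bigD + 2.

Definition gprod (x y : X) : \bar R :=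
  mine (mdist e x)%:E (mine (mdist e y)%:E
    (ereal_sup [set t%:E | t in
       [set t | 0 <= t /\ mdist (hatg e x t) (hatg e y t) <= bigD1]])).

Definition Sinfty : set (nat -> X) :=
  [set x | (fun ij : nat * nat => gprod (x ij.1) (x ij.2))
             @ filter_prod \oo \oo --> +oo%E].

Definition bequiv (x y : nat -> X) : Prop :=
  (fun i => gprod (x i) (y i)) @ \oo --> +oo%E.

(* The quotient of Sinfty by bequiv, realized as the set of classes. *)
Definition is_class (c : set (nat -> X)) : Prop :=
  exists2 x, Sinfty x & c = [set y | Sinfty y /\ bequiv x y].

Definition boundary_pt : Type := {c : set (nat -> X) | is_class c}.

HB.instance Definition _ := gen_eqMixin boundary_pt.
HB.instance Definition _ := gen_choiceMixin boundary_pt.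

Definition bordification : Type := (X + boundary_pt)%type.

HB.instance Definition _ := gen_eqMixin bordification.
HB.instance Definition _ := gen_choiceMixin bordification.

Definition represents (x : bordification) : set (nat -> X) :=
  match x with
  | inl x0 => [set fun=> x0]
  | inr c => sval c
  end.

Definition egprod (x y : bordification) : \bar R :=
  ereal_sup [set limn_einf (fun i => gprod (u.1 i) (u.2 i)) |
             u in represents x `*` represents y].

(* The index n ranges over the positive integers, as n.+1. *)
Definition Vset (n : nat) : set (bordification * bordification) :=
  [set p | (n.+1%:R%:E < egprod p.1 p.2)%E] `|`
  [set p | exists x y : X, p = (inl x, inl y) /\ mdist x y < n.+1%:R^-1].

(* The topology of the uniformity with base (Vset n)_n. *)
Definition bord_open : set_system bordification :=
  [set U | forall x, U x -> exists n, forall y, Vset n (x, y) -> U y].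

Lemma Vset_le n m : (n <= m)%N -> Vset m `<=` Vset n.
Proof.
move=> nm [p q] /= [mp|[x [y [-> xy]]]]; [left|right].
  by apply: le_lt_trans mp; rewrite lee_fin ler_nat.
exists x, y; split=> //; apply: lt_le_trans xy _.
by rewrite lef_pV2 ?posrE ?ltr0n// ler_nat.
Qed.

Lemma bord_openT : bord_open setT.
Proof. by move=> x _; exists 0%N. Qed.

Lemma bord_openI : setI_closed bord_open.
Proof.
move=> A B oA oB x [/oA[n An] /oB[m Bm]]; exists (maxn n m) => y Vy; split.
  by apply: An; apply: Vset_le Vy; rewrite leq_maxl.
by apply: Bm; apply: Vset_le Vy; rewrite leq_maxr.
Qed.

Lemma bord_open_bigU (I : Type) (f : I -> set bordification) :
  (forall i, bord_open (f i)) -> bord_open (\bigcup_i f i).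
Proof.
by move=> of_ x [i _ /of_[n fn]]; exists n => y /fn fy; exists i.
Qed.

HB.instance Definition _ := isOpenTopological.Build bordification
  bord_openT bord_openI bord_open_bigU.

Definition boundary : topologicalType :=
  initial_topology (inr : boundary_pt -> bordification).

End IdealBoundary.

Arguments boundary {R X}.

Definition open_cover (T : topologicalType) (A : set (set T)) : Prop :=
  [/\ finite_set A, A `<=` open & \bigcup_(U in A) U = setT].

Definition covering_dim_le (T : topologicalType) (n : nat) : Prop :=
  forall A : set (set T), open_cover A ->
    exists B : set (set T), [/\ open_cover B,
      forall V, B V -> exists2 U, A U & V `<=` U &
      forall x, [set V | B V /\ V x] #<= `I_n.+1].

(* Valued in {0, 1, ..., +oo}; in particular the empty space has dimension 0. *)
Definition covering_dim (R : realType) (T : topologicalType) : \bar R :=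
  ereal_inf [set n%:R%:E | n in covering_dim_le T].

Record net (R : realType) (X : metricType R) := Net {
  net_pts : discreteTopologicalType ;
  net_map : net_pts -> X ;
  net_proper : forall K, compact K -> compact (net_map @^-1` K) ;
  net_base : X ;
  net_baseP : range net_map net_base }.

Lemma interp_neq0 (R : realType) (A t : R) : 0 <= A <= 1 -> 0 < t < 1 ->
  (1 - t) * A + t * 1 <> 0 /\ (1 - t) * 1 + t * A <> 0.
Proof. by move=> ? ?; split=> ?; nra. Qed.

Section FreeProduct.
Context {R : realType} {X Y : metricType R} (NX : net X) (NY : net Y)
  (oX : net_pts NX) (oY : net_pts NY).

Definition letterX : Type := {a : net_pts NX | a <> oX}.
Definition letterY : Type := {b : net_pts NY | b <> oY}.

(* wordX is W_X and wordY is W_Y: an alternating word ending in y is w'y with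
   w' in W_Y, and one ending in x is w'x with w' in W_X.  The empty word occurs
   in both types, as emptyX and as emptyY. *)
Inductive wordX : Type :=
  | emptyX
  | snocY of wordY & letterY
with wordY : Type :=
  | emptyY
  | snocX of wordX & letterX.

Scheme wordX_mut := Induction for wordX Sort Prop
  with wordY_mut := Induction for wordY Sort Prop.

(* The set W of all words, which indexes the edges. *)
Inductive word : Type :=
  | word0
  | wordx of wordX & letterX
  | wordy of wordY & letterY.

(* The interior of the edge w is identified with ]0, 1[; its endpoints are
   points of the copies of X and Y. *)
Inductive free_product : Type :=
  | ptX of wordX & X
  | ptY of wordY & Y
  | ptE of word & {t : R | 0 < t < 1}.

HB.instance Definition _ := gen_eqMixin free_product.
HB.instance Definition _ := gen_choiceMixin free_product.

Definition foot (w : word) : free_product :=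
  match w with
  | word0 => ptX emptyX (net_base NX)
  | wordx w' x => ptX w' (net_map (sval x))
  | wordy w' y => ptY w' (net_map (sval y))
  end.

Definition head (w : word) : free_product :=
  match w with
  | word0 => ptY emptyY (net_base NY)
  | wordx w' x => ptY (snocX w' x) (net_base NY)
  | wordy w' y => ptX (snocY w' y) (net_base NX)
  end.

(* The point at parameter t of the closed edge w. *)
Definition edge_pt (w : word) (t : R) : free_product :=
  if insub t is Some t' then ptE w t' else if t <= 0 then foot w else head w.

Inductive piece : Type :=
  | copyX of wordX
  | copyY of wordY
  | edge of word.

(* A pair of points of a common piece; edges are parametrized by [0, 1]. *)
Inductive segment : Type :=
  | segX of wordX & X & X
  | segY of wordY & Y & Y
  | segE of word & {i01 R} & {i01 R}.

HB.instance Definition _ := gen_eqMixin segment.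
HB.instance Definition _ := gen_choiceMixin segment.

Definition seg_piece (s : segment) : piece :=
  match s with
  | segX w _ _ => copyX w
  | segY w _ _ => copyY w
  | segE w _ _ => edge w
  end.

Definition seg_src (s : segment) : free_product :=
  match s with
  | segX w x _ => ptX w x
  | segY w y _ => ptY w y
  | segE w a _ => edge_pt w a%:num
  end.

Definition seg_tgt (s : segment) : free_product :=
  match s with
  | segX w _ x => ptX w x
  | segY w _ y => ptY w y
  | segE w _ a => edge_pt w a%:num
  end.

Definition seg_len (s : segment) : R :=
  match s with
  | segX _ x x' => mdist x x'
  | segY _ y y' => mdist y y'
  | segE _ a b => `|a%:num - b%:num|
  end.

Fixpoint is_chain (p q : free_product) (l : seq segment) : Prop :=
  if l is s :: l' then seg_src s = p /\ is_chain (seg_tgt s) q l' else p = q.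

Definition chain_len (l : seq segment) : R := \sum_(s <- l) seg_len s.

(* X and Y being geodesic, the induced length metric is the gluing metric: the
   infimum of the lengths of the chains joining two points. *)
Definition fp_dist (p q : free_product) : R :=
  inf [set chain_len l | l in is_chain p q].

Lemma edge_pt0 w : edge_pt w 0 = foot w.
Proof. by rewrite /edge_pt insubF ?ltxx// lexx. Qed.

Lemma edge_pt1 w : edge_pt w 1 = head w.
Proof. by rewrite /edge_pt insubF ?ltxx ?andbF// ler10. Qed.

Lemma edge_ptE w (t : {t : R | 0 < t < 1}) : edge_pt w (val t) = ptE w t.
Proof. by rewrite /edge_pt valK. Qed.

Lemma seg_len_ge0 s : 0 <= seg_len s.
Proof. by case: s => [w x x'|w y y'|w a b] /=; rewrite ?mdist_ge0. Qed.

Lemma chain_len_ge0 l : 0 <= chain_len l.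
Proof. by apply: sumr_ge0 => s _; apply: seg_len_ge0. Qed.

Lemma chain_cat p q r l l' :
  is_chain p q l -> is_chain q r l' -> is_chain p r (l ++ l').
Proof.
elim: l p => [|s l IH] p /=; first by move=> ->.
by move=> [-> ?] ?; split=> //; apply: IH.
Qed.

Lemma chain_rcons p l s :
  is_chain p (seg_src s) l -> is_chain p (seg_tgt s) (rcons l s).
Proof. by move=> pl; rewrite -cats1; apply: chain_cat pl _. Qed.

Definition seg_rev (s : segment) : segment :=
  match s with
  | segX w x x' => segX w x' x
  | segY w y y' => segY w y' y
  | segE w a b => segE w b a
  end.

Lemma seg_len_rev s : seg_len (seg_rev s) = seg_len s.
Proof. by case: s => [w x x'|w y y'|w a b] /=; rewrite 1?metric_sym 1?distrC. Qed.

Lemma chain_rev p q l :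
  is_chain p q l -> is_chain q p (rev (map seg_rev l)).
Proof.
elim: l p => [|s l IH] p /=; first by move=> ->.
move=> [<- /IH ql]; rewrite rev_cons.
have -> : seg_src s = seg_tgt (seg_rev s) by case: s {ql}.
by apply: chain_rcons; have -> : seg_src (seg_rev s) = seg_tgt s by case: s {ql}.
Qed.

Lemma chain_len_rev l : chain_len (rev (map seg_rev l)) = chain_len l.
Proof.
rewrite /chain_len big_rev big_map; apply: eq_bigr => s _; exact: seg_len_rev.
Qed.

Lemma fp_dist_le p q l : is_chain p q l -> fp_dist p q <= chain_len l.
Proof.
move=> pql; apply: ge_inf; last by exists l.
by exists 0 => _ [l' _ <-]; apply: chain_len_ge0.
Qed.

Let i0 : {i01 R} := 0%:i01.
Let i1 : {i01 R} := 1%:i01.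

Lemma chain_exists p q : exists l, is_chain p q l.
Proof.
pose r := ptX emptyX (net_base NX); pose con p := exists l, is_chain p r l.
suff H p' : con p'.
  have [l pl] := H p; have [l' ql'] := H q.
  by exists (l ++ rev (map seg_rev l')); apply: chain_cat pl _; apply: chain_rev.
have headfoot w : con (foot w) -> con (head w).
  move=> [l fl]; exists (segE w i1 i0 :: l); split; first exact: edge_pt1.
  by rewrite /= edge_pt0.
have XX w x x' : con (ptX w x) -> con (ptX w x').
  by move=> [l xl]; exists (segX w x' x :: l).
have YY w y y' : con (ptY w y) -> con (ptY w y').
  by move=> [l yl]; exists (segY w y' y :: l).
have conr : con r by exists [::].
have conX : (forall w x, con (ptX w x)) /\ (forall w y, con (ptY w y)).
  split.
    apply: (@wordX_mut (fun w => forall x, con (ptX w x))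
                       (fun w => forall y, con (ptY w y))).
    - by move=> x; apply: XX conr.
    - by move=> w IH b x; apply: XX (headfoot (wordy w b) _); apply: IH.
    - by move=> y; apply: YY (headfoot word0 conr).
    - by move=> w IH a y; apply: YY (headfoot (wordx w a) _); apply: IH.
  apply: (@wordY_mut (fun w => forall x, con (ptX w x))
                     (fun w => forall y, con (ptY w y))).
  - by move=> x; apply: XX conr.
  - by move=> w IH b x; apply: XX (headfoot (wordy w b) _); apply: IH.
  - by move=> y; apply: YY (headfoot word0 conr).
  - by move=> w IH a y; apply: YY (headfoot (wordx w a) _); apply: IH.
case: p' => [w x|w y|w t]; [exact: conX.1|exact: conX.2|].
have [l fl] : con (foot w) by case: w => [|w a|w b]; [|exact: conX.1|exact: conX.2].
have t01 : 0 <= val t <= 1 by case: t => /= t /andP[t0 t1]; rewrite !ltW.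
exists (segE w (Itv01 (andP t01).1 (andP t01).2) i0 :: l); split => /=.
  by rewrite edge_ptE.
by rewrite edge_pt0.
Qed.

Lemma fp_dist_ge p q z :
  (forall l, is_chain p q l -> z <= chain_len l) -> z <= fp_dist p q.
Proof.
move=> zl; apply: lb_le_inf; last by move=> _ [l pql <-]; exact: zl.
by have [l pql] := chain_exists p q; exists (chain_len l), l.
Qed.

Lemma fp_distxx p : fp_dist p p = 0.
Proof.
apply/eqP; rewrite eq_le; apply/andP; split.
  by have := @fp_dist_le p p [::] erefl; rewrite /chain_len big_nil.
by apply: fp_dist_ge => l _; apply: chain_len_ge0.
Qed.

Lemma fp_dist_sym p q : fp_dist p q = fp_dist q p.
Proof.
have H p' q' : fp_dist p' q' <= fp_dist q' p'.
  by apply: fp_dist_ge => l /chain_rev /fp_dist_le; rewrite chain_len_rev.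
by apply/eqP; rewrite eq_le !H.
Qed.

Lemma fp_dist_triangle q p r : fp_dist p r <= fp_dist p q + fp_dist q r.
Proof.
rewrite -lerBlDr; apply: fp_dist_ge => l pql.
rewrite lerBlDr addrC -lerBlDr; apply: fp_dist_ge => l' qrl'.
rewrite lerBlDr addrC.
by have := fp_dist_le (chain_cat pql qrl'); rewrite /chain_len big_cat.
Qed.

Lemma fp_dist_lip (f : free_product -> R) p q :
  (forall s, `|f (seg_src s) - f (seg_tgt s)| <= seg_len s) ->
  `|f p - f q| <= fp_dist p q.
Proof.
move=> lipf; apply: fp_dist_ge => l; elim: l p => [|s l IH] p /=.
  by move=> ->; rewrite subrr normr0 chain_len_ge0.
move=> [<- /IH fl]; rewrite /chain_len big_cons.
by apply: le_trans (lerD (lipf s) fl); apply: ler_distD.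
Qed.

Definition fp_fun (fX : wordX -> X -> R) (fY : wordY -> Y -> R)
    (fE : word -> R -> R) (p : free_product) : R :=
  match p with ptX w x => fX w x | ptY w y => fY w y | ptE w t => fE w (val t) end.

Lemma fp_fun_lip fX fY fE (f := fp_fun fX fY fE) p q :
  (forall w x x', `|fX w x - fX w x'| <= mdist x x') ->
  (forall w y y', `|fY w y - fY w y'| <= mdist y y') ->
  (forall w s t, 0 <= s <= 1 -> 0 <= t <= 1 -> `|fE w s - fE w t| <= `|s - t|) ->
  (forall w, fE w 0 = f (foot w)) -> (forall w, fE w 1 = f (head w)) ->
  `|f p - f q| <= fp_dist p q.
Proof.
move=> lX lY lE f0 f1.
have fe w (a : {i01 R}) : f (edge_pt w a%:num) = fE w a%:num.
  have a0 : 0 <= a%:num by []. have a1 : a%:num <= 1 by [].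
  rewrite /edge_pt; case: insubP => [t _ <-|] //=.
  case: ifPn => [a0' _|].
    by rewrite -f0; have -> : a%:num = 0 by apply/le_anti/andP.
  rewrite -ltNge => -> /=; rewrite -leNgt => a1'.
  by rewrite -f1; have -> : a%:num = 1 by apply/le_anti/andP.
apply: fp_dist_lip => -[w x x'|w y y'|w a b] /=; [exact: lX|exact: lY|].
by rewrite !fe; apply: lE; apply/andP.
Qed.

Lemma fp_dist_positivity p q : fp_dist p q = 0 -> p = q.
Proof.
have minlip (T : metricType R) (z x x' : T) (c : R) :
    `|Num.min (mdist z x) c - Num.min (mdist z x') c| <= mdist x x'.
  have := metric_triangle z x x'; have := metric_triangle z x' x.
  rewrite (metric_sym x' x) ler_norml.
  by have := mdist_ge0 x x';
    case: (lerP (mdist z x) c); case: (lerP (mdist z x') c); lra.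
have interp (A B s t : R) : 0 <= A <= 1 -> 0 <= B <= 1 ->
    `|((1 - s) * A + s * B) - ((1 - t) * A + t * B)| <= `|s - t|.
  move=> A01 B01.
  have -> : ((1 - s) * A + s * B) - ((1 - t) * A + t * B) = (s - t) * (B - A) by ring.
  by rewrite normrM ler_piMr// ler_norml; apply/andP; split; lra.
have ptXE w0 x0 r : fp_dist (ptX w0 x0) r = 0 -> ptX w0 x0 = r.
  move=> d0.
  pose fX w x := if `[< w = w0 >] then Num.min (mdist x0 x) 1 else 1 : R.
  pose fV v := if v is ptX w x then fX w x else 1.
  pose fE w (t : R) := (1 - t) * fV (foot w) + t * fV (head w).
  have fX01 w x : 0 <= fX w x <= 1.
    rewrite /fX; case: ifP; rewrite ?ler01 ?lexx//.
    by rewrite le_min mdist_ge0 ler01 ge_min lexx orbT.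
  have fV01 v : 0 <= fV v <= 1 by case: v => *; rewrite /= ?fX01// ler01 lexx.
  have p0 : fX w0 x0 = 0 by rewrite /fX asboolT// mdistxx min_l.
  have : `|fX w0 x0 - fp_fun fX (fun _ _ => 1) fE r| <= 0.
    rewrite -d0; apply: (@fp_fun_lip fX (fun _ _ => 1) fE (ptX w0 x0) r) =>
      [w x x'|w y y'|w s t s01 t01|w|w].
    - by rewrite /fX; case: ifP => _; [exact: minlip|rewrite subrr normr0 mdist_ge0].
    - by rewrite subrr normr0 mdist_ge0.
    - by apply: interp; apply: fV01.
    - by rewrite /fE subr0 mul1r mul0r addr0; case: w.
    - by rewrite /fE subrr mul1r mul0r add0r; case: w.
  rewrite p0 sub0r normrN normr_le0 => H.
  case: r d0 H => [w x|w y|w [t t01]] _ /=.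
  - rewrite /fX; case: asboolP => [->|_]; last by rewrite oner_eq0.
    case: (lerP (mdist x0 x) 1) => _; last by rewrite oner_eq0.
    by move=> /eqP/mdist_positivity ->.
  - by rewrite oner_eq0.
  - rewrite /fE => /eqP.
    case: w => [|w a|w b] /=.
    + by move/(interp_neq0 (fX01 _ _) t01).1.
    + by move/(interp_neq0 (fX01 _ _) t01).1.
    + by move/(interp_neq0 (fX01 _ _) t01).2.
have ptYE w0 y0 r : fp_dist (ptY w0 y0) r = 0 -> ptY w0 y0 = r.
  move=> d0.
  pose fY w y := if `[< w = w0 >] then Num.min (mdist y0 y) 1 else 1 : R.
  pose fV v := if v is ptY w y then fY w y else 1.
  pose fE w (t : R) := (1 - t) * fV (foot w) + t * fV (head w).
  have fY01 w y : 0 <= fY w y <= 1.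
    rewrite /fY; case: ifP; rewrite ?ler01 ?lexx//.
    by rewrite le_min mdist_ge0 ler01 ge_min lexx orbT.
  have fV01 v : 0 <= fV v <= 1 by case: v => *; rewrite /= ?fY01// ler01 lexx.
  have p0 : fY w0 y0 = 0 by rewrite /fY asboolT// mdistxx min_l.
  have : `|fY w0 y0 - fp_fun (fun _ _ => 1) fY fE r| <= 0.
    rewrite -d0; apply: (@fp_fun_lip (fun _ _ => 1) fY fE (ptY w0 y0) r) =>
      [w x x'|w y y'|w s t s01 t01|w|w].
    - by rewrite subrr normr0 mdist_ge0.
    - by rewrite /fY; case: ifP => _; [exact: minlip|rewrite subrr normr0 mdist_ge0].
    - by apply: interp; apply: fV01.
    - by rewrite /fE subr0 mul1r mul0r addr0; case: w.
    - by rewrite /fE subrr mul1r mul0r add0r; case: w.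
  rewrite p0 sub0r normrN normr_le0 => H.
  case: r d0 H => [w x|w y|w [t t01]] _ /=.
  - by rewrite oner_eq0.
  - rewrite /fY; case: asboolP => [->|_]; last by rewrite oner_eq0.
    case: (lerP (mdist y0 y) 1) => _; last by rewrite oner_eq0.
    by move=> /eqP/mdist_positivity ->.
  - rewrite /fE => /eqP.
    case: w => [|w a|w b] /=.
    + by move/(interp_neq0 (fY01 _ _) t01).2.
    + by move/(interp_neq0 (fY01 _ _) t01).2.
    + by move/(interp_neq0 (fY01 _ _) t01).1.
case: p q => [w x|w y|w0 t0] [w' x'|w' y'|w1 t1] d0; try exact: ptXE; try exact: ptYE.
- by apply/esym/ptXE; rewrite fp_dist_sym.
- by apply/esym/ptYE; rewrite fp_dist_sym.
pose c := Num.min (val t0) (1 - val t0).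
have c0 : 0 < c by rewrite /c lt_min subr_gt0; case: (t0).
pose fE w t := if `[< w = w0 >] then Num.min `|val t0 - t| c else c.
have p0 : fE w0 (val t0) = 0.
  by rewrite /fE asboolT// subrr normr0 min_l// ltW.
have : `|fE w0 (val t0) - fE w1 (val t1)| <= 0.
  apply: le_trans (_ : fp_dist (ptE w0 t0) (ptE w1 t1) <= 0); last by rewrite d0.
  apply: (@fp_fun_lip (fun _ _ => c) (fun _ _ => c) fE (ptE w0 t0) (ptE w1 t1)) =>
    [w x x'|w y y'|w s t s01 t01|w|w].
  - by rewrite subrr normr0 mdist_ge0.
  - by rewrite subrr normr0 mdist_ge0.
  - rewrite /fE; case: ifP => _; last by rewrite subrr normr0.
    by have := @minlip R^o (val t0) s t c; rewrite /mdist /= ![`|_ - val t0|]distrC [`|t - s|]distrC.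
  - have -> : fE w 0 = c.
      rewrite /fE; case: ifP => // _; rewrite subr0 min_r// ger0_norm.
        by rewrite /c ge_min lexx.
      by case: (t0) => /= t /andP[/ltW].
    by case: w.
  - have -> : fE w 1 = c.
      rewrite /fE; case: ifP => // _; rewrite min_r// distrC ger0_norm.
        by rewrite /c ge_min lexx orbT.
      by rewrite subr_ge0; case: (t0) => /= t /andP[_ /ltW].
    by case: w.
rewrite p0 sub0r normrN normr_le0 /fE.
case: asboolP => [->|_]; last by rewrite gt_eqF.
case: (lerP `|val t0 - val t1| c) => _; last by rewrite gt_eqF.
by rewrite normr_eq0 subr_eq0 => /eqP/val_inj ->.
Qed.

HB.instance Definition _ := isMetric.Build R free_product
  fp_distxx fp_dist_positivity fp_dist_sym fp_dist_triangle.

(* A chain visiting each piece at most once; as the pieces are arranged in a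
   tree, such a chain exists and is unique up to segments of length 0. *)
Definition is_reduced_chain (p q : free_product) (l : seq segment) : Prop :=
  is_chain p q l /\
  pairwise (fun a b => `[< a <> b >]) (map seg_piece l).

Definition reduced_chain (p q : free_product) : seq segment :=
  xget [::] (is_reduced_chain p q).

Context (gX : X -> X -> R -> X) (gY : Y -> Y -> R -> Y).

Definition seg_at (s : segment) (t : R) : free_product :=
  match s with
  | segX w x x' => ptX w (gX x x' t)
  | segY w y y' => ptY w (gY y y' t)
  | segE w a b => edge_pt w ((1 - t) * a%:num + t * b%:num)
  end.

(* The point at arc length t of the concatenation of the segments of l. *)
Fixpoint walk (p : free_product) (l : seq segment) (t : R) : free_product :=
  if l is s :: l' then
    if t <= seg_len s then seg_at s (t / seg_len s)
    else walk (seg_tgt s) l' (t - seg_len s)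
  else p.

Definition fp_bicombing (p q : free_product) (t : R) : free_product :=
  walk p (reduced_chain p q) (t * chain_len (reduced_chain p q)).

End FreeProduct.

(* Main.v *)
Require Import Defs.
From mathcomp Require Import all_boot all_order all_algebra.
From mathcomp Require Import all_classical all_reals all_analysis.
From mathcomp Require Import ring lra.

Set Implicit Arguments.
Unset Strict Implicit.
Unset Printing Implicit Defensive.

Import Order.TTheory GRing.Theory Num.Theory.
Import numFieldNormedType.Exports numFieldTopology.Exports.

Local Open Scope classical_set_scope.
Local Open Scope card_scope.
Local Open Scope ring_scope.

(** The boundary of the free product is the disjoint union of one copy of
    the boundary of X or of Y for each copy of X or Y, and of the infinite
    words. Each edge cuts the space at its foot, so the boundary points
    beyond it form an open and closed set; these sets form a tree of
    cylinders, in which the boundary of a copy is the core of a cylinder: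
    what enters none of its branches (core_addrX, core_addrY).

    The boundaries of X and Y embed as closed subspaces, hence the dimension
    is at least the maximum (covering_dim_le_embedding). That the embedding
    is topological, and that neither the base point nor the constants
    matter, comes from one comparison: an isometric map preserving the
    bicombings preserves, up to constants, the time during which two
    geodesics fellow travel (gprod_fwd, gprod_bwd). For the inclusion of a
    copy the bicombing is preserved because a reduced chain between points
    of a copy is a single segment up to segments of length 0
    (fp_bicombing_ptX), as the projections to the pieces show.

    For the upper bound no compactness is available, since X and Y need not
    be proper, and the countable sum theorem does not apply, since there may
    be uncountably many copies. Instead a finite open cover is refined
    directly (covering_dim_le_tree). On each core the dimension hypothesis
    gives a refinement of order at most N + 1. A branch that comes close to
    a point of the core is wholly close to it, because the edge leading to
    it must be far away (cylinder_shrink); so the branch is absorbed whole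
    by the members of the refinement whose trace it is near to, and choosing
    the radii so that these members share a point of the core keeps the
    order. A branch that is absorbed lies in one member of the given cover,
    and nothing needs to be done beyond it. The branches that lie in no
    member of the cover are treated in the same way by their own cores.
    Infinite words are reached after finitely many steps, because cylinders
    along an infinite word shrink to a point (cylinder_lim). *)

(** * Fellow-travelling geodesics and the boundary product *)

(** The two bicombing geodesics issued from e towards x and y still run at time
    T, and are then within r of each other. Up to constants, the boundary product is
    the last such time for one fixed radius; leaving the radius free makes the
    relation easy to combine and to move between spaces and base points. *)
Definition fellow (R : realType) (X : metricType R) (g : X -> X -> R -> X) (e : X)
    (r T : R) (x y : X) : Prop :=
  [/\ 0 <= T, T <= mdist e x, T <= mdist e y &
    mdist (hatg g e x T) (hatg g e y T) <= r].

Section CoarseGeometry.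
Context {R : realType} {X : metricType R} {E C : R} {g : X -> X -> R -> X}.
Context (hg : coarsely_convex E C g).

Lemma coarsely_convex_E1 : 1 <= E. Proof. by case: hg. Qed.
Lemma coarsely_convex_C0 : 0 <= C. Proof. by case: hg. Qed.
Lemma coarsely_convex_bicombing : geodesic_bicombing g. Proof. by case: hg. Qed.

Lemma mdist_lip (x y z : X) : `|mdist x y - mdist x z| <= mdist y z.
Proof.
rewrite ler_norml; have := metric_triangle x y z; have := metric_triangle x z y.
by rewrite (metric_sym z y); lra.
Qed.

(** The degenerate cases of hatg are consistent: its value is the rescaled
    bicombing also when e = x, since then t = 0. *)
Lemma hatgE (e x : X) t : 0 <= t <= mdist e x -> hatg g e x t = g e x (t / mdist e x).
Proof.
move=> /andP[t0 tx]; rewrite /hatg tx andbT; case: eqVneq => // ex.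
have [g0 _ _] := coarsely_convex_bicombing e x.
have -> : t = 0 by move: tx; rewrite -ex mdistxx; lra.
by rewrite mul0r g0 ex.
Qed.

Lemma hatg_frac (e x : X) t : 0 <= t <= mdist e x -> 0 <= t / mdist e x <= 1.
Proof.
move=> /andP[t0 tx]; rewrite divr_ge0 ?mdist_ge0//=.
have := mdist_ge0 e x; rewrite le_eqVlt => /predU1P[<-|d0];
  first by rewrite invr0 mulr0 ler01.
by rewrite ler_pdivrMr// mul1r.
Qed.

Lemma hatg_fracK (e x : X) t : 0 <= t <= mdist e x -> t / mdist e x * mdist e x = t.
Proof.
move=> /andP[t0 tx]; have [d0|] := eqVneq (mdist e x) 0; last by move=> ?; rewrite divfK.
by rewrite d0 mulr0; move: t0 tx; rewrite d0; lra.
Qed.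

Lemma hatg_dist e x s t : 0 <= s <= mdist e x -> 0 <= t <= mdist e x ->
  mdist (hatg g e x s) (hatg g e x t) = `|s - t|.
Proof.
move=> hs ht; rewrite !hatgE//; have [_ _ ->] := coarsely_convex_bicombing e x;
  rewrite ?hatg_frac//.
rewrite -[X in _ * X](@ger0_norm _ (mdist e x)) ?mdist_ge0// -normrM.
by rewrite mulrBl !hatg_fracK.
Qed.

Lemma hatg0 e x : hatg g e x 0 = e.
Proof.
rewrite hatgE ?lexx ?mdist_ge0// mul0r.
by have [-> _ _] := coarsely_convex_bicombing e x.
Qed.

Lemma hatg1 e x : hatg g e x (mdist e x) = x.
Proof.
rewrite /hatg lexx andbT; case: eqVneq => // ex.
rewrite divff; first by have [_ -> _] := coarsely_convex_bicombing e x.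
by apply: contra_neq ex => /mdist_positivity.
Qed.

Lemma hatg_distl e x t : 0 <= t <= mdist e x -> mdist e (hatg g e x t) = t.
Proof.
move=> ht; rewrite -{1}(hatg0 e x) hatg_dist ?lexx ?mdist_ge0//.
by rewrite sub0r normrN ger0_norm//; case/andP: ht.
Qed.

Lemma hatg_distr e x t : 0 <= t <= mdist e x ->
  mdist (hatg g e x t) x = mdist e x - t.
Proof.
move=> ht; rewrite -{2}(hatg1 e x) hatg_dist ?lexx ?mdist_ge0//.
by rewrite distrC ger0_norm// subr_ge0; case/andP: ht.
Qed.

Lemma fellow_sym e r T x y : fellow g e r T x y -> fellow g e r T y x.
Proof. by case=> *; split=> //; rewrite metric_sym. Qed.

(** This is the only use of coarse convexity for geodesics with a common
    origin: the term in the distance of the origins vanishes, so that going back to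
    the fraction c of the time shrinks the divergence by c, up to constants. *)
Lemma fellow_scale e r T x y c : fellow g e r T x y -> 0 <= c <= 1 ->
  fellow g e (c * E * r + C) (c * T) x y.
Proof.
case=> T0 Tx Ty xy /andP[c0 c1].
have cT0 : 0 <= c * T by rewrite mulr_ge0.
have cTT : c * T <= T by rewrite ler_piMl.
split; rewrite ?(le_trans cTT)//.
have [_ _ _ cvx] := hg.
have fx : 0 <= T / mdist e x <= 1 by rewrite hatg_frac// T0.
have fy : 0 <= T / mdist e y <= 1 by rewrite hatg_frac// T0.
have := cvx e e x y _ _ c fx fy; rewrite c0 c1 => /(_ isT).
rewrite !mulrA -!hatgE ?T0 ?cT0 ?(le_trans cTT)// mdistxx mulr0 add0r => /le_trans; apply.
by rewrite lerD2r ler_wpM2l// mulr_ge0// (le_trans _ coarsely_convex_E1).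
Qed.

Lemma fellow_le e r T S x y : fellow g e r T x y -> 0 <= S <= T ->
  fellow g e (E * r + C) S x y.
Proof.
move=> n /andP[S0 ST]; have [T0 Tx Ty r0] := n.
have [T_0|T_n0] := eqVneq T 0.
  have -> : S = T by lra.
  by have := fellow_scale n (c := 1); rewrite !mul1r ler01 lexx; apply.
have Tp : 0 < T by rewrite lt_def T_n0.
have c01 : 0 <= S / T <= 1 by rewrite divr_ge0//= ler_pdivrMr// mul1r.
have := fellow_scale n c01; rewrite divfK// => -[? ? ? h]; split=> //.
apply: le_trans h _; rewrite lerD2r -mulrA ler_piMl//; last by case/andP: c01.
by rewrite mulr_ge0 ?(le_trans _ coarsely_convex_E1)// (le_trans _ r0)// mdist_ge0.
Qed.

Lemma fellow_trans e r s T x y z : fellow g e r T x y -> fellow g e s T y z ->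
  fellow g e (r + s) T x z.
Proof.
case=> T0 Tx Ty xy [_ _ Tz yz]; split=> //.
by apply: le_trans (metric_triangle _ _ _) _; apply: lerD xy yz.
Qed.

(** Moving the base point moves the geodesics to a fixed endpoint by a bounded
    amount: convexity compares them at equal fractions of their lengths, and these
    lengths differ by at most the distance of the base points. *)
Lemma hatg_base e e' x T : 0 <= T -> T <= mdist e x -> T <= mdist e' x ->
  mdist (hatg g e x T) (hatg g e' x T) <= (E + 1) * mdist e e' + C.
Proof.
move=> T0 Tx Tx'.
have hx : 0 <= T <= mdist e x by rewrite T0.
have hx' : 0 <= T <= mdist e' x by rewrite T0.
have [_ _ _ cvx] := hg; have bx := coarsely_convex_bicombing e x; have bx' :=
  coarsely_convex_bicombing e' x.
have f := hatg_frac hx; have f' := hatg_frac hx'.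
set c := T / mdist e x in f *.
have := cvx e e' x x 1 1 c; rewrite ler01 lexx => /(_ isT isT f).
case: bx => _ -> gx; case: bx' => _ -> gx'; rewrite mdistxx mulr0 addr0 !mulr1 => h.
rewrite (hatgE hx) (hatgE hx') -/c.
apply: le_trans (metric_triangle _ (g e' x c) _) _.
have : mdist (g e' x c) (g e' x (T / mdist e' x)) <= mdist e e'.
  rewrite gx'//; rewrite -[X in _ * X](@ger0_norm _ (mdist e' x)) ?mdist_ge0// -normrM.
  rewrite mulrBl (hatg_fracK hx').
  have -> : c * mdist e' x - T = c * (mdist e' x - mdist e x).
    by rewrite mulrBr /c (hatg_fracK hx).
  rewrite normrM ger0_norm; last by case/andP: f.
  have := mdist_lip x e' e; rewrite (metric_sym x e') (metric_sym x e) (metric_sym e'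
    e) => le1.
  by apply: le_trans le1; rewrite ler_piMl// ; case/andP: f.
have : (1 - c) * E * mdist e e' <= E * mdist e e'.
  by case/andP: f => c0 c1; rewrite ler_wpM2r ?mdist_ge0//; have :=
    coarsely_convex_E1; nra.
by lra.
Qed.

(** The time is decreased by the distance of the base points so that both
    geodesics from the new base point are still running. *)
Lemma fellow_base e e' r T x y : fellow g e r T x y -> mdist e e' <= T ->
  fellow g e' (E * r + C + 2 * ((E + 1) * mdist e e' + C)) (T - mdist e e') x y.
Proof.
move=> n dT; have := fellow_le n (S := T - mdist e e').
rewrite subr_ge0 dT gerBl mdist_ge0 => /(_ isT) [S0 Sx Sy h].
have [T0 Tx Ty _] := n.
have le' z : T <= mdist e z -> T - mdist e e' <= mdist e' z.
  by move=> Tz; rewrite lerBlDl; apply: le_trans Tz (metric_triangle _ _ _).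
split; rewrite ?le'//.
have := hatg_base S0 Sx (le' _ Tx); have := hatg_base S0 Sy (le' _ Ty).
rewrite [mdist (hatg g e x _) _]metric_sym.
set a := hatg g e' x _ in h *; set b := hatg g e' y _ in h *.
set a' := hatg g e x _ in h *; set b' := hatg g e y _ in h *.
have := metric_triangle a a' b; have := metric_triangle a' b' b; lra.
Qed.

(** The radius at which two geodesics are known to fellow travel up to the time
    given by their product. The product also allows a time at which the shorter
    geodesic has already stopped, which costs a factor 2 before convexity is used. *)
Definition slack : R := 2 * E * Defs.bigD1 E C + C.

Lemma bigD1_ge : 2 * C + 10 <= Defs.bigD1 E C.
Proof. by have := coarsely_convex_E1; rewrite /Defs.bigD1 /bigD; lra. Qed.

Lemma slack_ge : Defs.bigD1 E C <= slack.
Proof. by have := coarsely_convex_E1; have := coarsely_convex_C0; have := bigD1_ge;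
  rewrite /slack; nra. Qed.

Lemma gprod_sym e x y : gprod E C g e x y = gprod E C g e y x.
Proof.
rewrite /gprod minCA; congr (mine _ (mine _ (ereal_sup _))).
by apply/seteqP; split=> _ [t [t0 h] <-]; exists t => //; split=> //; rewrite metric_sym.
Qed.

Lemma fellow_gprod e T x y : fellow g e (Defs.bigD1 E C) T x y ->
  (T%:E <= gprod E C g e x y)%E.
Proof.
case=> T0 Tx Ty xy; rewrite /gprod !le_min !lee_fin Tx Ty /=.
by apply: ereal_sup_ubound; exists T.
Qed.

Lemma gprod_dist e T x y : (T%:E < gprod E C g e x y)%E ->
  T < mdist e x /\ T < mdist e y.
Proof. by rewrite /gprod !lt_min !lte_fin => /and3P[-> ->]. Qed.

(** Converse of fellow_gprod, with a larger radius. If the witness t of the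
    product exceeds the length of one of the geodesics, then t is replaced by the
    length of the shorter one, at the cost of another bigD1. *)
Lemma gprod_fellow e T x y : 0 <= T -> (T%:E < gprod E C g e x y)%E ->
  fellow g e slack T x y.
Proof.
move=> T0 Tg; have [Tx Ty] := gprod_dist Tg.
wlog xy : x y Tg Tx Ty / mdist e x <= mdist e y.
  move=> H; have [xy|/ltW yx] := leP (mdist e x) (mdist e y); first exact: H.
  by apply: fellow_sym; apply: H => //; rewrite gprod_sym.
move: Tg; rewrite /gprod !lt_min => /and3P[_ _ /ereal_sup_gt[_ [t [t0 D] <-]]].
rewrite lte_fin => Tt.
suff [S [TS n]] : exists S, T <= S /\ fellow g e (2 * Defs.bigD1 E C) S x y.
  have := fellow_le n (S := T); rewrite T0 TS => /(_ isT).
  by rewrite /slack [E * _]mulrCA mulrA.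
have Dp := bigD1_ge; have C0 := coarsely_convex_C0; have x0 := mdist_ge0 e x.
have [tx|xt] := leP t (mdist e x).
  exists t; split; first exact: ltW.
  by split; rewrite ?(le_trans tx)// (le_trans D)//; lra.
exists (mdist e x); split; first exact: ltW.
split=> //; rewrite hatg1.
have hx : hatg g e x t = x by rewrite /hatg leNgt xt andbF.
rewrite hx in D.
have hy0 : 0 <= mdist e x <= mdist e y by rewrite x0.
have [ty|yt] := leP t (mdist e y).
  have hy : 0 <= t <= mdist e y by rewrite t0.
  have := hatg_dist hy hy0; rewrite ger0_norm; last by lra.
  have := mdist_lip e x (hatg g e y t); rewrite ler_norml (hatg_distl hy).
  have := metric_triangle x (hatg g e y t) (hatg g e y (mdist e x)); lra.
move: D; have -> : hatg g e y t = y by rewrite /hatg leNgt yt andbF.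
move=> D; have := hatg_distr hy0; have := mdist_lip e x y; rewrite ler_norml.
have := metric_triangle x y (hatg g e y (mdist e x)).
by rewrite (metric_sym y (hatg _ _ _ _)); lra.
Qed.

(** Going back to this fraction of the time brings geodesics that are r-close
    down to the radius bigD1 at which the product is measured. *)
Definition shrink (r : R) : R := (E * r + 1)^-1.

Lemma shrink_gt0 r : 0 <= r -> 0 < shrink r.
Proof. by move=> r0; rewrite invr_gt0; have := coarsely_convex_E1; nra. Qed.

Lemma fellow_shrink e r T x y : fellow g e r T x y ->
  ((shrink r * T)%:E <= gprod E C g e x y)%E.
Proof.
move=> n; have r0 : 0 <= r by case: n => _ _ _; apply: le_trans (mdist_ge0 _ _).
have s0 := shrink_gt0 r0; have E1 := coarsely_convex_E1.
have s1 : shrink r <= 1 by rewrite invf_le1; nra.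
have := fellow_scale n (c := shrink r); rewrite ltW//= s1 => /(_ isT) [? ? ? h].
apply: fellow_gprod; split=> //; apply: le_trans h _.
have -> : shrink r * E * r = 1 - shrink r.
  by rewrite /shrink; field; nra.
by have := bigD1_ge; have := coarsely_convex_C0; lra.
Qed.

Lemma gprod_diag e x : ((mdist e x)%:E <= gprod E C g e x x)%E.
Proof.
apply: fellow_gprod; split; rewrite ?mdist_ge0// mdistxx.
by have := bigD1_ge; have := coarsely_convex_C0; lra.
Qed.

Lemma gprod_close e x y : mdist x y <= 1 ->
  ((mdist e x - 1)%:E <= gprod E C g e x y)%E.
Proof.
move=> xy; have x0 := mdist_ge0 e x; have y0 := mdist_ge0 e y.
have := mdist_lip e x y; rewrite ler_norml => /andP[h1 h2].
have [lt1|ge1] := ltP (mdist e x) 1.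
  apply: (@le_trans _ _ 0%:E); first by rewrite lee_fin; lra.
  apply: fellow_gprod; split; rewrite ?lexx// !hatg0 mdistxx.
  by have := bigD1_ge; have := coarsely_convex_C0; lra.
apply: fellow_gprod; split; [lra|lra|lra|].
have hx : 0 <= mdist e x - 1 <= mdist e x by apply/andP; split; lra.
have hy : 0 <= mdist e x - 1 <= mdist e y by apply/andP; split; lra.
have := hatg_distr hx; have := hatg_distr hy.
have := metric_triangle (hatg g e x (mdist e x - 1)) x (hatg g e y (mdist e x - 1)).
have := metric_triangle x y (hatg g e y (mdist e x - 1)).
rewrite (metric_sym y (hatg _ _ _ _)); have := bigD1_ge; have := coarsely_convex_C0; lra.
Qed.

Lemma slack_ge0 : 0 <= slack.
Proof. by have := slack_ge; have := bigD1_ge; have := coarsely_convex_C0; lra. Qed.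

Definition ultra_factor : R := shrink (slack + slack).

Lemma ultra_factor_gt0 : 0 < ultra_factor.
Proof. by apply: shrink_gt0; have := slack_ge0; lra. Qed.

(** The product is a quasi-ultrametric: concatenating two fellow-travelling
    pairs doubles the radius, and shrinking the time restores it. *)
Lemma gprod_ultra e T x y z : 0 <= T -> (T%:E < gprod E C g e x y)%E ->
  (T%:E < gprod E C g e y z)%E -> ((ultra_factor * T)%:E <= gprod E C g e x z)%E.
Proof.
move=> T0 /(gprod_fellow T0) xy /(gprod_fellow T0) yz.
exact: fellow_shrink (fellow_trans xy yz).
Qed.

(** The point h separates S from its complement: every distance across is
    realized through h. *)
Definition is_cut (S : set X) (h : X) : Prop :=
  forall a b, S a -> ~ S b -> mdist a b = mdist a h + mdist h b.

Lemma is_cutC S h : is_cut S h -> is_cut (~` S) h.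
Proof.
move=> cS a b Sa /contrapT Sb; rewrite metric_sym (cS b a)// addrC.
by rewrite (metric_sym h b) (metric_sym a h).
Qed.

(** Points on different sides of a cut diverge soon after h: at a time T past h,
    one geodesic has crossed to the other side, at distance at least T - d(e,h) from
    h, and it can only be joined to the other geodesic through h. *)
Lemma gprod_cut_le e S h p q T : is_cut S h -> S p -> ~ S q -> 0 <= T ->
  (T%:E < gprod E C g e p q)%E -> T <= mdist e h + slack.
Proof.
wlog Se : S p q / ~ S e.
  move=> H cS Sp Sq T0 Tg; have [Se|Se] := pselect (S e); last exact: (H S p q).
  by apply: (H (~` S) q p) => //=; [exact: is_cutC|rewrite gprod_sym].
move=> cS Sp Sq T0 /(gprod_fellow T0)[_ Tp Tq D]; rewrite leNgt; apply/negP => lt.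
have sl := slack_ge0.
have hp : 0 <= T <= mdist e p by rewrite T0.
have hq : 0 <= T <= mdist e q by rewrite T0.
have cut' a b : ~ S a -> S b -> mdist a b = mdist a h + mdist h b.
  by move=> Sa Sb; rewrite metric_sym (cS b a)// addrC (metric_sym h b) (metric_sym a h).
have dp := hatg_distl hp; have rp := hatg_distr hp.
have dq := hatg_distl hq; have rq := hatg_distr hq.
have SP : S (hatg g e p T).
  apply: contrapT => nS; move: rp; rewrite (cut' _ _ nS Sp) (cut' _ _ Se Sp).
  by have := mdist_ge0 (hatg g e p T) h; lra.
have dP : T - mdist e h <= mdist (hatg g e p T) h.
  by have := metric_triangle e h (hatg g e p T); rewrite dp (metric_sym h); lra.
have [SQ|SQ] := pselect (S (hatg g e q T)).
  move: dq rq; rewrite (cut' _ _ Se SQ) (cS _ _ SQ Sq) (metric_sym (hatg g e q T) h).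
  by have := metric_triangle e h q; have := mdist_ge0 h (hatg g e q T); lra.
by move: D; rewrite (cS _ _ SP SQ); have := mdist_ge0 h (hatg g e q T); lra.
Qed.

(** Both geodesics pass through h, at the same time. *)
Lemma gprod_cut_ge e S h p q : is_cut S h -> ~ S e -> S p -> S q ->
  ((mdist e h)%:E <= gprod E C g e p q)%E.
Proof.
move=> cS Se Sp Sq.
have cut' b : S b -> mdist e b = mdist e h + mdist h b.
  by move=> Sb; rewrite metric_sym (cS b e)// addrC (metric_sym h b) (metric_sym e h).
have hat b : S b -> hatg g e b (mdist e h) = h.
  move=> Sb; have hb : 0 <= mdist e h <= mdist e b.
    by rewrite mdist_ge0 (cut' b Sb) lerDl mdist_ge0.
  have := hatg_distl hb; have := hatg_distr hb.
  have := mdist_ge0 (hatg g e b (mdist e h)) h.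
  set m := hatg g e b _ => m0; have [Sm|Sm] := pselect (S m).
    rewrite (cut' m Sm) (metric_sym h m) => _ m1.
    by apply: mdist_positivity; lra.
  rewrite (metric_sym m b) (cS b m)// (cut' b Sb) (metric_sym b h) => m1 _.
  by apply: mdist_positivity; rewrite metric_sym; lra.
apply: fellow_gprod; split; rewrite ?mdist_ge0//;
  try by rewrite (cut' _ Sp, cut' _ Sq) lerDl mdist_ge0.
by rewrite (hat _ Sp) (hat _ Sq) mdistxx; have := bigD1_ge; have :=
  coarsely_convex_C0; lra.
Qed.

End CoarseGeometry.

Arguments slack {R} E C.
Arguments shrink {R} E r.
Arguments ultra_factor {R} E C.

(** * The uniformity of the ideal boundary *)

(** A base of a uniformity indexed by the integers, with a map half making the
    composition of two entourages explicit. That half is monotone allows a finite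
    family of radii to be compared through the smallest of them. *)
Definition uniform_base (T : topologicalType) (V : nat -> T -> T -> Prop)
    (half : nat -> nat) : Prop :=
  [/\ forall A : set T, open A <-> (forall x, A x -> exists n, forall y, V n x y -> A y),
      forall n x, V n x x,
      forall n x y, V n x y -> V n y x,
      forall n m x y, (n <= m)%N -> V m x y -> V n x y &
      {homo half : n m / (n <= m)%N} /\
      forall n x y z, V (half n) x y -> V (half n) y z -> V n x z].

Section Boundary.
Context {R : realType} {X : metricType R} {E C : R} {g : X -> X -> R -> X}
  {e : X}.
Context (hg : coarsely_convex E C g).
Local Notation gp := (gprod E C g e).
Local Notation bpt := (boundary_pt E C g e).
Implicit Types (u v w : nat -> X) (xi eta : bpt).

(** Closeness at the level of representatives; a lower bound on an extended
    product is equivalent to it up to a bounded factor. *)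
Definition seq_close (T : R) u v : Prop :=
  exists N, forall i, (N <= i)%N -> (T%:E < gp (u i) (v i))%E.

Lemma seq_close_sym T u v : seq_close T u v -> seq_close T v u.
Proof. by move=> [N h]; exists N => i /h; rewrite gprod_sym. Qed.

Lemma seq_close_le S T u v : S <= T -> seq_close T u v -> seq_close S u v.
Proof.
by move=> ST [N h]; exists N => i /h; apply: le_lt_trans; rewrite lee_fin.
Qed.

(** An integer multiple large enough for gprod_ultra to lose nothing: above
    this multiple of S on both sides, the composed product is above S. *)
Definition ultra_mult : nat := (Num.trunc (ultra_factor E C)^-1).+1.

Lemma ultra_mult_gt : (ultra_factor E C)^-1 < ultra_mult%:R.
Proof. by rewrite /ultra_mult truncnS_gt. Qed.

Lemma ultra_mult_ge1 : 1 <= ultra_mult%:R :> R.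
Proof. by rewrite ler1n. Qed.

Lemma gprod_trans (S : R) x y z : 0 < S -> ((ultra_mult%:R * S)%:E < gp x y)%E ->
  ((ultra_mult%:R * S)%:E < gp y z)%E -> (S%:E < gp x z)%E.
Proof.
move=> S0 xy yz; have T0 : 0 <= ultra_mult%:R * S by rewrite mulr_ge0// ltW.
apply: lt_le_trans (gprod_ultra hg T0 xy yz).
rewrite lte_fin mulrA ltr_pMl// -ltr_pdivrMl ?mulr1 ?ultra_mult_gt//.
exact: ultra_factor_gt0 hg.
Qed.

Lemma seq_close_trans S u v w : 0 < S -> seq_close (ultra_mult%:R * S) u v ->
  seq_close (ultra_mult%:R * S) v w -> seq_close S u w.
Proof.
move=> S0 [N uv] [M vw]; exists (maxn N M) => i; rewrite geq_max => /andP[Ni Mi].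
exact: gprod_trans S0 (uv _ Ni) (vw _ Mi).
Qed.

Lemma SinftyP u : Sinfty E C g e u <-> forall T : R, exists N, forall i j,
  (N <= i)%N -> (N <= j)%N -> (T%:E < gp (u i) (u j))%E.
Proof.
split=> [/cvgeyPgt uoo T|H].
  have [[A B] /= [[N _ NA] [M _ MB]] AB] := uoo T.
  exists (maxn N M) => i j; rewrite !geq_max => /andP[Ni _] /andP[_ Mj].
  by apply: (AB (i, j)); split; [exact: NA|exact: MB].
apply/cvgeyPgt => T; have [N h] := H T.
exists ([set i | (N <= i)%N], [set i | (N <= i)%N]); last by move=> [i j] []; exact: h.
by split; exists N.
Qed.

Lemma bequivP u v : bequiv E C g e u v <-> forall T : R, seq_close T u v.
Proof.
split=> [/cvgeyPgt uv T|H]; first by have [N _ h] := uv T; exists N => i /h.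
by apply/cvgeyPgt => T; have [N h] := H T; exists N.
Qed.

Lemma bequiv_refl u : Sinfty E C g e u -> bequiv E C g e u u.
Proof.
by move=> /SinftyP h; apply/bequivP => T; have [N H] := h T; exists N => i Ni; apply: H.
Qed.

Lemma bequiv_sym u v : bequiv E C g e u v -> bequiv E C g e v u.
Proof. by move=> /bequivP uv; apply/bequivP => T; apply: seq_close_sym. Qed.

Lemma bequiv_trans u v w : bequiv E C g e u v -> bequiv E C g e v w ->
  bequiv E C g e u w.
Proof.
move=> /bequivP uv /bequivP vw; apply/bequivP => T.
apply: (@seq_close_le _ (`|T| + 1)); first by have := ler_norm T; lra.
by apply: seq_close_trans (uv _) (vw _); have := normr_ge0 T; lra.
Qed.

Lemma rep_ex xi : exists u, sval xi u.
Proof.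
by case: (svalP xi) => u Su ->; exists u; split=> //; exact: bequiv_refl.
Qed.

Lemma rep_Sinfty xi u : sval xi u -> Sinfty E C g e u.
Proof. by case: (svalP xi) => v Sv -> []. Qed.

Lemma rep_equiv xi u v : sval xi u -> sval xi v -> bequiv E C g e u v.
Proof.
case: (svalP xi) => w Sw -> [_ wu] [_ wv]; exact: bequiv_trans (bequiv_sym wu) wv.
Qed.

Lemma rep_closed xi u v : sval xi u -> Sinfty E C g e v -> bequiv E C g e u v ->
  sval xi v.
Proof.
by case: (svalP xi) => w Sw -> [_ wu] Sv uv; split=> //; exact: bequiv_trans uv.
Qed.

(** The classes are sets of sequences, so that sharing one representative
    already makes them equal. *)
Lemma rep_inj xi eta u : sval xi u -> sval eta u -> xi = eta.
Proof.
move=> xu yu; suff : sval xi = sval eta by move: xi eta {xu yu} =>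
  [c hc] [d hd] /= cd; exact: eq_exist.
apply/seteqP; split=> v h.
  by apply: rep_closed yu (rep_Sinfty h) (rep_equiv xu h).
by apply: rep_closed xu (rep_Sinfty h) (rep_equiv yu h).
Qed.

Lemma rep_mk u : Sinfty E C g e u -> exists xi : bpt, sval xi u.
Proof.
move=> Su.
have hc : is_class E C g e [set v | Sinfty E C g e v /\ bequiv E C g e u v] by exists u.
by exists (exist _ _ hc); split=> //; exact: bequiv_refl.
Qed.

Local Notation bord := (bordification E C g e).

(** The supremum defining the extended product is attained up to a bounded
    factor at any choice of representatives, by pt_close_reps. This relation only
    asks for one choice. *)
Definition pt_close (T : R) (p q : bord) : Prop :=
  exists u v, [/\ represents p u, represents q v & seq_close T u v].

Lemma egprod_pt_close T p q : (T%:E < egprod p q)%E -> pt_close T p q.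
Proof.
move=> /ereal_sup_gt[_ [[u v] /= [pu qv] <-]].
rewrite limn_einf_lim (cvg_lim _ (@cvg_einfs_sup _ _))// => /ereal_sup_gt[_ [N _ <-]] TN.
exists u, v; split=> //; exists N => i Ni; apply: lt_le_trans TN _.
by apply: ereal_inf_lbound; exists i.
Qed.

Lemma pt_close_egprod T p q : pt_close T p q -> (T%:E <= egprod p q)%E.
Proof.
move=> [u [v [pu qv [N h]]]].
apply: (@le_trans _ _ (limn_einf (fun i => gp (u i) (v i)))); last first.
  by apply: ereal_sup_ubound; exists (u, v).
rewrite limn_einf_lim (cvg_lim _ (@cvg_einfs_sup _ _))//.
apply: le_trans (ereal_sup_ubound _); last by exists N.
by apply: le_ereal_inf_tmp => _ [i Ni <-]; apply/ltW/h.
Qed.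

Lemma pt_close_sym T p q : pt_close T p q -> pt_close T q p.
Proof. by move=> [u [v [? ? ?]]]; exists v, u; split=> //; exact: seq_close_sym. Qed.

Lemma pt_close_le S T p q : S <= T -> pt_close T p q -> pt_close S p q.
Proof. by move=> ST [u [v [? ? ?]]]; exists u, v; split=> //;
  exact: seq_close_le ST _. Qed.

(** For a point of the space the only representative is constant and its product
    with itself is its distance to the base point, so the bound has to come from
    some v; for a boundary point it holds without bound. *)
Lemma seq_close_self S T (p : bord) u u' v : represents p u -> represents p u' ->
  seq_close T u v ->
  S <= T -> seq_close S u u'.
Proof.
case: p => [x|xi] /=.
  move=> -> -> [N h] ST; exists N => i /h /gprod_dist[Tx _].
  by apply: lt_le_trans (gprod_diag hg e x); rewrite lte_fin; exact: le_lt_trans Tx.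
by move=> xu xu' _ _; have /bequivP := rep_equiv xu xu'; apply.
Qed.

Lemma pt_close_reps S (p q : bord) u v : 0 < S ->
  pt_close (ultra_mult%:R * (ultra_mult%:R * S)) p q ->
  represents p u -> represents q v -> seq_close S u v.
Proof.
move=> S0 [u0 [v0 [pu0 qv0 uv]]] pu qv; have m1 := ultra_mult_ge1.
have uu := seq_close_self pu0 pu uv (lexx _).
have vv := seq_close_self qv0 qv (seq_close_sym uv) (lexx _).
have mS : 0 < ultra_mult%:R * S by rewrite mulr_gt0// (lt_le_trans ltr01).
apply: seq_close_trans (_ : seq_close _ u v0) _ => //.
  exact: seq_close_trans (seq_close_sym uu) uv.
by apply: seq_close_le vv; rewrite ler_peMl// ltW.
Qed.

Lemma rep_ex_bord (p : bord) : exists u, represents p u.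
Proof. by case: p => [x|xi]; [exists (fun=> x)|exact: rep_ex]. Qed.

Lemma pt_close_trans S p q r : 0 < S ->
  pt_close (ultra_mult%:R * (ultra_mult%:R * (ultra_mult%:R * S))) p q ->
  pt_close (ultra_mult%:R * (ultra_mult%:R * (ultra_mult%:R * S))) q r -> pt_close S p r.
Proof.
move=> S0 pq qr; have [u pu] := rep_ex_bord p; have [v qv] := rep_ex_bord q.
have [w rw] := rep_ex_bord r; exists u, w; split=> //.
have mS : 0 < ultra_mult%:R * S by rewrite mulr_gt0// (lt_le_trans ltr01 ultra_mult_ge1).
by apply: seq_close_trans (pt_close_reps _ pq pu qv) (pt_close_reps _ qr qv rw).
Qed.

(** Two changes of representatives and one composition cost three factors
    ultra_mult; the factor 2 makes the final inequality strict. *)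
Definition bdry_half (n : nat) : nat := (ultra_mult ^ 3 * 2 * n.+1)%N.

Lemma bdry_half_mono : {homo bdry_half : n m / (n <= m)%N}.
Proof. by move=> n m nm; rewrite leq_mul2l ltnS nm orbT. Qed.

Lemma bdry_half_trans n p q r : pt_close (bdry_half n)%:R p q ->
  pt_close (bdry_half n)%:R q r ->
  (n.+1%:R%:E < egprod p r)%E.
Proof.
have -> : (bdry_half n)%:R = ultra_mult%:R * (ultra_mult%:R * (ultra_mult%:R * (2 *
  n.+1%:R))) :> R.
  by rewrite /bdry_half !natrM; ring.
move=> pq qr; have n0 : 0 < n.+1%:R :> R by rewrite ltr0n.
have h := pt_close_trans (_ : 0 < 2 * n.+1%:R) pq qr.
apply: lt_le_trans (pt_close_egprod (h _)); last by rewrite mulr_gt0.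
by rewrite lte_fin ltr_pMl// ltr1n.
Qed.

Definition bdry_near (n : nat) xi eta : Prop :=
  (n.+1%:R%:E < egprod (inr xi : bord) (inr eta))%E.

Lemma bdry_near_pt_close n xi eta : bdry_near n xi eta ->
  pt_close n.+1%:R (inr xi) (inr eta).
Proof. exact: egprod_pt_close. Qed.

Lemma pt_close_bdry_near n (T : R) xi eta : n.+1%:R < T ->
  pt_close T (inr xi) (inr eta) ->
  bdry_near n xi eta.
Proof. by move=> nT /pt_close_egprod; apply: lt_le_trans; rewrite lte_fin. Qed.

Lemma bdry_near_sym n xi eta : bdry_near n xi eta -> bdry_near n eta xi.
Proof.
rewrite /bdry_near; suff -> : egprod (inr xi : bord) (inr eta) = egprod (inr eta :
  bord) (inr xi) by [].
congr ereal_sup; apply/seteqP; split=> _ [[u v] /= [pu pv] <-]; exists (v, u) => //=;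
  by congr limn_einf; apply/funext => i; rewrite gprod_sym.
Qed.

Lemma bdry_near_refl n xi : bdry_near n xi xi.
Proof.
have [u xu] := rep_ex xi; apply: (@pt_close_bdry_near _ n.+2%:R);
  first by rewrite ltr_nat.
exists u, u; split=> //; have /bequivP := bequiv_refl (rep_Sinfty xu); exact.
Qed.

Lemma bdry_near_le n m xi eta : (n <= m)%N -> bdry_near m xi eta -> bdry_near n xi eta.
Proof. by move=> nm; apply: le_lt_trans; rewrite lee_fin ler_nat. Qed.

Lemma bdry_near_half n xi eta zeta : bdry_near (bdry_half n) xi eta ->
  bdry_near (bdry_half n) eta zeta ->
  bdry_near n xi zeta.
Proof.
move=> /bdry_near_pt_close xe /bdry_near_pt_close ez; apply: bdry_half_trans.
  by apply: pt_close_le xe; rewrite ler_nat.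
by apply: pt_close_le ez; rewrite ler_nat.
Qed.

(** The boundary carries the trace of the topology of the bordification. A set
    stable under small boundary moves is the trace of the set of all points having
    an entourage whose boundary points lie in it, and this set is open because
    entourages compose, even through the points of the space at small distance. *)
Lemma boundary_open (A : set (boundary E C g e)) :
  open A <-> forall xi, A xi -> exists n, forall eta, bdry_near n xi eta -> A eta.
Proof.
split=> [[B oB <-] xi /= /oB[n h]|H].
  by exists n => eta ne; apply: h; left.
pose B : set bord := [set p | exists m, forall eta : bpt, Vset m (p, inr eta) -> A eta].
have V_close m p p' : (exists x y, p = inl x /\ p' = inl y /\ mdist x y < 1) \/ p = p' \/
  pt_close (bdry_half m)%:R p p' ->
    forall eta, Vset (bdry_half m).+1 (p', inr eta) -> Vset m (p, inr eta).
  move=> pp eta [/=/egprod_pt_close|[x [y []]]//] p'e; left => /=.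
  have p'e' : pt_close (bdry_half m)%:R p' (inr eta) by apply: pt_close_le p'e;
    rewrite ler_nat -addn2 leq_addr.
  case: pp => [[x [y [-> [p'y xy]]]]|[->|pp]].
  - rewrite p'y in p'e' p'e; apply: bdry_half_trans p'e'.
    exists (fun=> x), (fun=> y); split=> //; exists 0%N => _ _.
    rewrite gprod_sym; apply: lt_le_trans (gprod_close hg e (_ : mdist y x <= 1));
      last by rewrite metric_sym ltW.
    have [u [v [/= -> _ [N h]]]] := p'e; have [yd _] := gprod_dist (h _ (leqnn N)).
    by rewrite lte_fin ltrBrDr; apply: le_lt_trans yd; rewrite natr1 ler_nat.
  - apply: lt_le_trans (pt_close_egprod p'e'); rewrite lte_fin ltr_nat.
    by rewrite /bdry_half -[X in (X < _)%N]mul1n ltn_pmul2r// (@leq_trans (1 * 2)) //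
      leq_mul2r expn_gt0.
  - exact: bdry_half_trans pp p'e'.
exists B.
  move=> p [m hm]; exists (bdry_half m) => p' pp'.
  exists (bdry_half m).+1 => eta p'e; apply: hm.
  apply: (V_close m p p') p'e.
  case: pp' => /= [/egprod_pt_close pp|[x [y [[-> ->] xy]]]].
    by right; right; apply: pt_close_le pp; rewrite ler_nat.
  left; exists x, y; split=> //; split=> //; apply: lt_le_trans xy _.
  by rewrite invf_le1 ?ler1n ?ltr0n.
apply/seteqP; split=> [xi [m hm]|xi Axi].
  by apply: hm; left; exact: bdry_near_refl.
by have [m hm] := H _ Axi; exists m => eta [/hm//|[x [y []]]].
Qed.

Lemma boundary_base :
  uniform_base (T := boundary E C g e) bdry_near bdry_half.
Proof.
split; [exact: boundary_open|exact: bdry_near_refl|exact: bdry_near_sym|exact: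
  bdry_near_le|].
by split; [exact: bdry_half_mono|exact: bdry_near_half].
Qed.

Definition eventually_in (S : set X) u : Prop := exists N, forall i, (N <= i)%N ->
  S (u i).

(** The boundary points lying beyond S. For a cut set, all the representatives
    agree on this by ends_in1. *)
Definition ends_in (S : set X) : set bpt :=
  [set xi | forall u, sval xi u -> eventually_in S u].

Lemma ends_in_sub S S' : S `<=` S' -> ends_in S `<=` ends_in S'.
Proof. by move=> SS xi h u /h[N hN]; exists N => i /hN/SS. Qed.

Lemma ends_in_disj S S' xi : (forall x, S x -> S' x -> False) -> ends_in S xi ->
  ends_in S' xi -> False.
Proof.
move=> SS h h'; have [u xu] := rep_ex xi; have [N hN] := h _ xu; have [M hM] := h' _ xu.
by apply: (SS (u (maxn N M))); [apply: hN; rewrite leq_maxl|apply: hM; rewrite leq_maxr].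
Qed.

Section Cut.
Context {S : set X} {h : X} (cS : is_cut S h).

Definition cut_bound : R := mdist e h + slack E C.

Lemma cut_bound_ge0 : 0 <= cut_bound.
Proof. by rewrite addr_ge0 ?mdist_ge0// (slack_ge0 hg). Qed.

(** A large product forbids the two points to be separated by the cut; this makes
    the boundary of each side of a cut open and closed. *)
Lemma cut_side p q : ((cut_bound + 1)%:E < gp p q)%E -> S p -> S q.
Proof.
move=> pq Sp; apply: contrapT => Sq; have b0 := cut_bound_ge0.
by have := gprod_cut_le hg cS Sp Sq (_ : 0 <= cut_bound + 1) pq; rewrite -/cut_bound; lra.
Qed.

Lemma cut_dichotomy u : Sinfty E C g e u -> eventually_in S u \/ eventually_in (~` S) u.
Proof.
move=> /SinftyP/(_ (cut_bound + 1))[N h']; have [SN|SN] := pselect (S (u N));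
  [left|right];
  exists N => i Ni.
  by apply: cut_side SN; apply: h'.
by move=> Si; apply: SN; apply: cut_side Si; apply: h'.
Qed.

Lemma ends_in1 xi u : sval xi u -> eventually_in S u -> ends_in S xi.
Proof.
move=> xu [N Su] v xv.
have /bequivP/(_ (cut_bound + 1))[M uv] := rep_equiv xu xv.
exists (maxn N M) => i; rewrite geq_max => /andP[Ni Mi].
by apply: cut_side (uv _ Mi) (Su _ Ni).
Qed.

Lemma ends_inC xi : ~ ends_in S xi -> ends_in (~` S) xi.
Proof.
move=> nS u xu; case: (cut_dichotomy (rep_Sinfty xu)) => // Su.
by exfalso; apply: nS; exact: ends_in1 Su.
Qed.

Lemma ends_in_bdry_near : exists n, forall xi eta, bdry_near n xi eta ->
  ends_in S xi -> ends_in S eta.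
Proof.
have [n hn] : exists n : nat, cut_bound + 1 <= n%:R.
  exists (Num.trunc (cut_bound + 1)).+1; exact/ltW/truncnS_gt.
exists n => xi eta /bdry_near_pt_close[u [v [xu ev [N h']]]] Sxi.
apply: (ends_in1 ev); have [M Su] := Sxi _ xu.
exists (maxn N M) => i; rewrite geq_max => /andP[Ni Mi].
apply: cut_side (Su _ Mi); apply: le_lt_trans (h' _ Ni).
by rewrite lee_fin (le_trans hn)// ler_nat.
Qed.

(** The boundary points beyond a cut form a small set when the cut is far from
    the base point. *)
Lemma cut_close xi eta T : ~ S e -> ends_in S xi -> ends_in S eta -> T < mdist e h ->
  pt_close T (inr xi) (inr eta).
Proof.
move=> Se Sx Sy Td; have [u xu] := rep_ex xi; have [v ev] := rep_ex eta.
have [N hN] := Sx _ xu; have [M hM] := Sy _ ev.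
exists u, v; split=> //; exists (maxn N M) => i; rewrite geq_max => /andP[Ni Mi].
by apply: lt_le_trans (gprod_cut_ge hg cS Se (hN _ Ni) (hM _ Mi)); rewrite lte_fin.
Qed.

Lemma cut_far xi eta T : 0 <= T -> pt_close T (inr xi) (inr eta) -> ends_in S xi ->
  ~ ends_in S eta ->
  T <= cut_bound.
Proof.
move=> T0 [u [v [xu ev [N h']]]] Sx /ends_inC Sy; have [N1 h1] := Sx _ xu;
  have [N2 h2] := Sy _ ev.
pose i := maxn N (maxn N1 N2).
have iN : (N <= i)%N by rewrite leq_maxl.
have iN1 : (N1 <= i)%N by rewrite leq_max leq_maxl orbT.
have iN2 : (N2 <= i)%N by rewrite leq_max leq_maxr orbT.
exact: (gprod_cut_le hg cS (h1 _ iN1) (h2 _ iN2) T0 (h' _ iN)).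
Qed.

End Cut.

End Boundary.

Arguments ultra_mult {R} E C.
Arguments bdry_half {R} E C n.
Arguments cut_bound {R X} E C e h.

(** * Boundary maps induced by geodesic embeddings *)

Section Transfer.
Context {R : realType} {X Z : metricType R} {EX CX E C : R}
  {gX : X -> X -> R -> X} {g : Z -> Z -> R -> Z}.
Context (hX : coarsely_convex EX CX gX) (hZ : coarsely_convex E C g).
Context (eX : X) (e : Z) (i : X -> Z).
Context (iso : forall x y, mdist (i x) (i y) = mdist x y)
  (geo : forall x y (t : R), 0 <= t <= 1 -> g (i x) (i y) t = i (gX x y t)).

Lemma hatg_transfer x T : 0 <= T <= mdist eX x ->
  hatg g (i eX) (i x) T = i (hatg gX eX x T).
Proof.
move=> hT; rewrite (hatgE hX hT) (hatgE hZ) iso// geo//.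
exact: hatg_frac hT.
Qed.

Lemma fellow_transfer r T x y : fellow gX eX r T x y <-> fellow g (i eX) r T (i x) (i y).
Proof.
rewrite /fellow !iso; split=> -[T0 Tx Ty].
  by rewrite !hatg_transfer ?T0// iso; split.
by rewrite !hatg_transfer ?T0// iso; split.
Qed.

(** An isometric map carrying bicombing geodesics to bicombing geodesics
    preserves fellow travelling from corresponding base points. Changing the base
    point and the radius afterwards gives products that control each other. The
    identity is allowed: the boundary does not depend on the base point, nor on the
    constants. *)
Lemma gprod_fwd (T : R) : exists T', forall x y,
  (T'%:E < gprod EX CX gX eX x y)%E -> (T%:E < gprod E C g e (i x) (i y))%E.
Proof.
pose d := mdist (i eX) e; have d0 : 0 <= d by exact: mdist_ge0.
pose r := E * slack EX CX + C + 2 * ((E + 1) * d + C).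
have r0 : 0 <= r.
  by have := slack_ge0 hX; have := coarsely_convex_E1 hZ; have :=
    coarsely_convex_C0 hZ; rewrite /r; nra.
have s0 := shrink_gt0 hZ r0.
have [t0 tT] : 0 <= (`|T| + 1) / shrink E r /\ T < `|T| + 1.
  by split; [apply: divr_ge0; [rewrite addr_ge0|exact: ltW]|have := ler_norm T; lra].
exists (d + (`|T| + 1) / shrink E r) => x y xy.
have /fellow_transfer n := gprod_fellow hX (addr_ge0 d0 t0) xy.
have := fellow_base hZ n (_ : mdist (i eX) e <= _); rewrite -/d lerDl => /(_ t0).
move=> /(fellow_shrink hZ); apply: lt_le_trans; rewrite lte_fin.
by rewrite [X in _ < _ * X]addrC addKr mulrC divfK// gt_eqF.
Qed.

Lemma gprod_bwd (T : R) : exists T', forall x y,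
  (T'%:E < gprod E C g e (i x) (i y))%E -> (T%:E < gprod EX CX gX eX x y)%E.
Proof.
pose d := mdist e (i eX); have d0 : 0 <= d by exact: mdist_ge0.
pose r := E * slack E C + C + 2 * ((E + 1) * d + C).
have r0 : 0 <= r.
  by have := slack_ge0 hZ; have := coarsely_convex_E1 hZ; have :=
    coarsely_convex_C0 hZ; rewrite /r; nra.
have s0 := shrink_gt0 hX r0.
have [t0 tT] : 0 <= (`|T| + 1) / shrink EX r /\ T < `|T| + 1.
  by split; [apply: divr_ge0; [rewrite addr_ge0|exact: ltW]|have := ler_norm T; lra].
exists (d + (`|T| + 1) / shrink EX r) => x y xy.
have n := gprod_fellow hZ (addr_ge0 d0 t0) xy.
have := fellow_base hZ n (_ : mdist e (i eX) <= _); rewrite -/d lerDl => /(_ t0).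
move=> /fellow_transfer/(fellow_shrink hX); apply: lt_le_trans; rewrite lte_fin.
by rewrite [X in _ < _ * X]addrC addKr mulrC divfK// gt_eqF.
Qed.

Local Notation bX := (boundary_pt EX CX gX eX).
Local Notation bZ := (boundary_pt E C g e).

Lemma Sinfty_transfer u : Sinfty EX CX gX eX u <-> Sinfty E C g e (i \o u).
Proof.
split=> /SinftyP H; apply/SinftyP => T.
  have [T' h] := gprod_fwd T; have [N hN] := H T'; exists N => k l Nk Nl.
  by apply: h; apply: hN.
have [T' h] := gprod_bwd T; have [N hN] := H T'; exists N => k l Nk Nl.
by apply: h; apply: hN.
Qed.

(** The extension of i to the boundaries, described by its effect on
    representatives. *)
Definition induced_map (phi : bX -> bZ) : Prop :=
  forall xi u, sval xi u -> sval (phi xi) (i \o u).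

Lemma induced_map_ex : exists phi, induced_map phi.
Proof.
have H (xi : bX) : exists eta : bZ, forall u, sval xi u -> sval eta (i \o u).
  have [u xu] := rep_ex xi; have /Sinfty_transfer Su := rep_Sinfty xu.
  have [eta eu] := rep_mk Su; exists eta => v xv.
  have /Sinfty_transfer Sv := rep_Sinfty xv.
  apply: (rep_closed hZ eu Sv); apply/bequivP => T; have [T' h] := gprod_fwd T.
  by have /bequivP/(_ T')[N hN] := rep_equiv hX xu xv; exists N => k /hN/h.
by have [phi hphi] := choice H; exists phi.
Qed.

Context (phi : bX -> bZ) (hphi : induced_map phi).

Lemma induced_map_near n : exists m, forall xi eta, bdry_near m xi eta ->
  bdry_near n (phi xi) (phi eta).
Proof.
have [T' h] := gprod_fwd n.+2%:R.
exists (Num.trunc T') => xi eta /bdry_near_pt_close[u [v [xu ev [N hN]]]].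
apply: (@pt_close_bdry_near _ _ _ _ _ _ _ n.+2%:R); first by rewrite ltr_nat.
exists (i \o u), (i \o v); split; [exact: hphi|exact: hphi|].
by exists N => k /hN; rewrite /= => uv; apply: h; apply: lt_trans uv;
  rewrite lte_fin truncnS_gt.
Qed.

Lemma induced_map_near_inv n :
  exists m, forall xi eta, bdry_near m (phi xi) (phi eta) -> bdry_near n xi eta.
Proof.
have [T' h] := gprod_bwd n.+2%:R.
pose S := `|T'| + 1; have S0 : 0 < S by have := normr_ge0 T'; rewrite /S; lra.
exists (Num.trunc ((ultra_mult E C)%:R * ((ultra_mult E C)%:R * S))) => xi eta.
move=> /bdry_near_pt_close/(pt_close_le (ltW (truncnS_gt _))) xe.
have [u xu] := rep_ex xi; have [v ev] := rep_ex eta.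
have [N hN] := pt_close_reps hZ S0 xe (hphi xu) (hphi ev).
apply: (@pt_close_bdry_near _ _ _ _ _ _ _ n.+2%:R); first by rewrite ltr_nat.
exists u, v; split=> //; exists N => k /hN; rewrite /= => uv; apply: h.
by apply: le_lt_trans uv; rewrite lee_fin /S; have := ler_norm T'; lra.
Qed.

End Transfer.

(** * Covering dimension *)

Lemma covering_dim_le_mono (T : topologicalType) n m : (n <= m)%N ->
  covering_dim_le T n -> covering_dim_le T m.
Proof.
move=> nm dn A /dn[B [oB BA cB]]; exists B; split=> // x.
by apply: card_le_trans (cB x) _; rewrite card_le_II.
Qed.

(** The members of a refinement may be merged along the members of the cover
    that contain them, without increasing the order. Indexing refinements by the
    cover lets refinements built on disjoint pieces be united. *)
Lemma covering_dim_le_shrink (T : topologicalType) n : covering_dim_le T n <->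
  forall A, open_cover A -> exists D : set T -> set T,
    [/\ forall U, A U -> open (D U) /\ D U `<=` U,
        forall x, exists2 U, A U & D U x &
        forall x, [set U | A U /\ D U x] #<= `I_n.+1].
Proof.
split=> H A oA.
  have [B [[_ oB cB] BA cardB]] := H _ oA.
  have H' V : exists U, B V -> A U /\ V `<=` U.
    by have [/BA[U AU VU]|nB] := pselect (B V); [exists U|exists set0].
  have [f hf] := choice H'.
  exists (fun U => \bigcup_(V in [set V | B V /\ f V = U]) V); split.
  - move=> U AU; split; first by apply: bigcup_open => V [/oB].
    by move=> x [V [BV <-] Vx]; apply: (hf _ BV).2.
  - move=> x; have : setT x by []. rewrite -cB => -[V BV Vx].
    by exists (f V); [exact: (hf _ BV).1|exists V].
  - move=> x; apply: card_le_trans (cardB x).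
    apply: card_le_trans (card_image_le f _); apply: subset_card_le.
    by move=> U [AU [V [BV fV] Vx]]; exists V.
have [D [oD cD cardD]] := H _ oA; have [finA _ _] := oA.
exists (D @` A); split.
- split; first exact: finite_image.
    by move=> _ [U AU <-]; exact: (oD _ AU).1.
  apply/seteqP; split=> // x _; have [U AU DU] := cD x.
  by exists (D U) => //; exists U.
- by move=> _ [U AU <-]; exists U => //; exact: (oD _ AU).2.
- move=> x; apply: card_le_trans (cardD x).
  apply: card_le_trans (card_image_le D _); apply: subset_card_le.
  by move=> _ [[U AU <-] DUx]; exists U.
Qed.

Lemma card_le_sub1 (T : Type) (A : set T) (a : T) n : A `<=` [set a] -> A #<= `I_n.+1.
Proof.
move=> Aa; apply: card_le_trans (subset_card_le Aa) _.
apply: (@card_le_trans _ _ _ `I_1); last by rewrite card_le_II.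
have -> : [set a] = (fun=> a) @` `I_1.
  by apply/seteqP; split=> [_ ->|_ [? _ <-]]//; exists 0%N.
exact: card_image_le.
Qed.

Lemma finite_argmax (T : choiceType) (A : set T) (f : T -> nat) : finite_set A ->
  A !=set0 ->
  exists2 a, A a & forall b, A b -> (f b <= f a)%N.
Proof.
move=> /finite_seqP[s ->] [b0 /=]; elim: s b0 => [|a s IH] b0 //= _.
case: s IH => [|b s] IH.
  by exists a; rewrite /= ?mem_head// => b; rewrite inE => /eqP ->.
have [c cs cmax] := IH b (mem_head _ _).
have [le|lt] := leqP (f c) (f a).
  exists a; first exact: mem_head.
  by move=> d /=; rewrite in_cons => /predU1P[->//|/cmax /leq_trans]; apply.
exists c; first by rewrite /= in_cons; apply/orP; right.
by move=> d /=; rewrite in_cons => /predU1P[->|/cmax//]; exact: ltnW.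
Qed.

Section ClosedEmbedding.
Context {S T : topologicalType} {W : nat -> S -> S -> Prop} {V : nat -> T -> T ->
  Prop} {k h : nat -> nat}.
Context (bS : @uniform_base S W k) (bT : @uniform_base T V h) (phi : S -> T).
Context (fwd : forall n, exists m, forall x y, W m x y -> V n (phi x) (phi y)).
Context (bwd : forall n, exists m, forall x y, V m (phi x) (phi y) -> W n x y).

Lemma embedding_continuous (B : set T) : open B -> open (phi @^-1` B).
Proof.
case: bS bT => oS _ _ _ _ [oT _ _ _ _] /oT oB; apply/oS => x /oB[n hn].
by have [m hm] := fwd n; exists m => y /hm/hn.
Qed.

(** This is the largest open subset of T whose trace on S lies in A. *)
Definition embedding_ext (A : set S) : set T :=
  [set z | exists m, forall s, V m z (phi s) -> A s].

Lemma embedding_ext_open A : open (embedding_ext A).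
Proof.
case: bT => oT _ _ _ [_ hT]; apply/oT => z [m hm]; exists (h m) => y zy.
by exists (h m) => s ys; apply: hm; apply: hT ys.
Qed.

Lemma embedding_extK A : open A -> phi @^-1` (embedding_ext A) = A.
Proof.
case: bS bT => oS _ _ _ _ [_ rT _ _ _] /oS oA; apply/seteqP; split=> x.
  by move=> [m]; apply.
by move=> /oA[n hn]; have [m hm] := bwd n; exists m => s /hm/hn.
Qed.

Lemma covering_dim_le_embedding n : open (~` range phi) -> covering_dim_le T n ->
  covering_dim_le S n.
Proof.
move=> closed /covering_dim_le_shrink dT; apply/covering_dim_le_shrink => A [finA oA cA].
have [|D [oD cD cardD]] := dT (embedding_ext @` A `|` [set ~` range phi]).
  split.
  - by rewrite finite_setU; split; [exact: finite_image|exact: finite_set1].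
  - by move=> _ [[U _ <-]|->//]; exact: embedding_ext_open.
  - apply/seteqP; split=> // z _; have [[x _ <-]|nz] := pselect (range phi z).
      have : setT x by []. rewrite -cA => -[U AU Ux].
      exists (embedding_ext U); first by left; exists U.
      by move: Ux; rewrite -{1}(embedding_extK (oA _ AU)).
    by exists (~` range phi) => //; right.
exists (fun U => phi @^-1` D (embedding_ext U)); split.
- move=> U AU; have [|oDU DU] := oD (embedding_ext U); first by left; exists U.
  split; first exact: embedding_continuous.
  by rewrite -[X in _ `<=` X](embedding_extK (oA _ AU)) => x /DU.
- move=> x; have [_ [[U AU <-]|->]] := cD (phi x); first by exists U.
  move=> /(oD _ _).2 []; last by exists x.
  by right.
- move=> x; apply: card_le_trans (cardD (phi x)).
  apply: card_le_trans (card_image_le (fun B => phi @^-1` B) _); apply: subset_card_le.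
  move=> U [AU DU]; exists (embedding_ext U); last exact/embedding_extK/oA.
  by split=> //; left; exists U.
Qed.

End ClosedEmbedding.

(** * Dimension of a space split by a tree of cylinders *)

Section Tree.
Context {T : topologicalType} {V : nat -> T -> T -> Prop} {h : nat -> nat}.
Context (bT : uniform_base V h) {I : Type} (Cyl : seq I -> set T) (N : nat).

(** The points whose descent in the tree stops exactly at p. *)
Definition core (p : seq I) : set T :=
  [set x | Cyl p x /\ forall i, ~ Cyl (rcons p i) x].

(** The consequence of dim F <= N for the traces on F of the finite open covers
    of T; openness relative to F is expressed by the entourages. *)
Definition rel_dim_le (F : set T) : Prop := forall A, open_cover A ->
  exists D : set T -> set T,
    [/\ forall U, A U -> D U `<=` F `&` U,
        forall U x, A U -> D U x -> exists n, forall y, F y -> V n x y -> D U y,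
        forall x, F x -> exists2 U, A U & D U x &
        forall x, [set U | A U /\ D U x] #<= `I_N.+1].

Context (cyl0 : Cyl [::] = setT) (cyl_open : forall p, open (Cyl p))
  (cyl_sub : forall p i, Cyl (rcons p i) `<=` Cyl p)
  (cyl_disj : forall p i j x, Cyl (rcons p i) x -> Cyl (rcons p j) x -> i = j)
  (core_dim : forall p, rel_dim_le (core p))
  (cyl_shrink : forall p x n, core p x -> exists m, forall i y z,
    Cyl (rcons p i) y -> Cyl (rcons p i) z -> V m x y -> V n x z)
  (cyl_lim : forall x n, (forall k, exists2 p, size p = k & Cyl p x) ->
    exists2 p, Cyl p x & forall y, Cyl p y -> V n x y).

Lemma cyl_take p k : Cyl p `<=` Cyl (take k p).
Proof.
elim/last_ind: p => [|p i IH] x; first by case: k.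
rewrite -cats1 take_cat; case: ltnP => [kp|pk]; first by rewrite cats1 => /cyl_sub/IH.
case: (k - size p)%N => [|m] /=; first by rewrite cats1 cats0 => /cyl_sub.
by rewrite cats1; case: m.
Qed.

Lemma cyl_comparable p q x : (size p <= size q)%N -> Cyl p x -> Cyl q x ->
  p = take (size p) q.
Proof.
elim/last_ind: p q => [|p i IH] q; first by rewrite take0.
rewrite size_rcons => pq px qx.
have pe := IH _ (ltnW pq) (cyl_sub px) qx.
have i0 := i; rewrite (take_nth i0)// -pe; congr rcons.
apply: (cyl_disj px (_ : Cyl (rcons p _) x)).
by rewrite [in rcons p]pe -take_nth//; exact: cyl_take qx.
Qed.

Lemma cyl_core x : (exists p, core p x) \/ (forall k, exists2 p, size p = k & Cyl p x).
Proof.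
have [|nc] := pselect (exists p, core p x); [by left|right].
elim=> [|k [p <- px]]; first by exists [::]; rewrite ?cyl0.
have /existsNP[i /contrapT ix] : ~ forall i, ~ Cyl (rcons p i) x.
  by move=> ni; apply: nc; exists p.
by exists (rcons p i); rewrite ?size_rcons.
Qed.

Section Cover.
Context (A : set (set T)) (oA : open_cover A).

(** A cylinder inside one member of the cover needs no further subdivision. *)
Definition small p : Prop := exists2 U, A U & Cyl p `<=` U.

Context (big0 : ~ small [::]) (D : seq I -> set T -> set T) (holder : seq I -> set T).
Context (D_sub : forall p U, A U -> D p U `<=` core p `&` U)
  (D_open : forall p U x, A U -> D p U x ->
    exists n, forall y, core p y -> V n x y -> D p U y)
  (D_cover : forall p x, core p x -> exists2 U, A U & D p U x)
  (D_card : forall p x, [set U | A U /\ D p U x] #<= `I_N.+1)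
  (holderP : forall p, small p -> A (holder p) /\ Cyl p `<=` holder p).

(** The members of the cover of the core of p that absorb the branch q. The
    half radius ensures that all the members absorbing q contain a common point of
    the core. *)
Definition attached p q : set (set T) := [set U | [/\ A U, Cyl q `<=` U & exists x n,
  [/\ D p U x, (forall y, core p y -> V n x y -> D p U y) &
      forall z, Cyl q z -> V (h n) x z]]].

(** The second case only ensures that a small branch far from the core is
    covered: a single member containing it is enough. *)
Definition assigned p q : set (set T) := [set U |
  attached p q U \/ attached p q = set0 /\ U = holder q].

(** The place where a point stops, going down the tree along the cylinders that
    contain it: the core of the last large one, or a first small one. It exists and
    is unique, so that no recursion on the tree is needed to define the cover. *)
Definition exits p x : Prop :=
  core p x \/ exists2 i, small (rcons p i) & Cyl (rcons p i) x.

Definition tree_cover (U : set T) : set T := [set x | exists p, ~ small p /\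
  (D p U x \/ exists i, [/\ small (rcons p i), Cyl (rcons p i) x &
                            assigned p (rcons p i) U])].

Lemma assigned_sub p q U : small q -> assigned p q U -> A U /\ Cyl q `<=` U.
Proof. by move=> sq [[]|[_ ->]] //; exact: holderP. Qed.

Lemma tree_cover_sub U : A U -> tree_cover U `<=` U.
Proof.
move=> AU x [p [_ [/(D_sub AU)[]//|[i [si ix /(assigned_sub si)[_]]]]]].
exact.
Qed.

(** At a point of the core the branches coming close are, by the shrinking
    hypothesis, wholly close; they are therefore small and absorbed by the same
    member. *)
Lemma tree_cover_open U : A U -> open (tree_cover U).
Proof.
case: bT => oT rT sT lT [hm hT] AU; apply/oT => x [p [bp [Dx|[i [si ix ai]]]]];
  last first.
  have /oT/(_ _ ix)[n hn] := cyl_open (rcons p i); exists n => y /hn iy.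
  by exists p; split=> //; right; exists i.
have [[px ncx] Ux] := D_sub AU Dx; have [n hn] := D_open AU Dx.
have [_ oA' _] := oA; have /oT/(_ _ Ux)[n2 hn2] := oA' _ AU.
have /oT/(_ _ px)[n3 hn3] := cyl_open p.
have [m hm'] := cyl_shrink (maxn (h n) n2) (conj px ncx : core p x).
exists (maxn n (maxn n3 m)) => y xy; exists p; split=> //.
have py : Cyl p y by apply: hn3; apply: lT xy; rewrite !leq_max leqnn !orbT.
have [cy|/existsNP[i /contrapT iy]] := pselect (forall i, ~ Cyl (rcons p i) y).
  by left; apply: hn => //; apply: lT xy; rewrite leq_maxl.
have zz z : Cyl (rcons p i) z -> V (maxn (h n) n2) x z.
  by move=> iz; apply: hm' iy iz _; apply: lT xy; rewrite !leq_max leqnn !orbT.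
have sub : Cyl (rcons p i) `<=` U.
  by move=> z /zz xz; apply: hn2; apply: lT xz; rewrite leq_maxr.
right; exists i; split=> //; first by exists U.
left; split=> //; exists x, n; split=> // z /zz xz.
by apply: lT xz; rewrite leq_maxl.
Qed.

Lemma small_take p k : small (take k p) -> small p.
Proof. by move=> [U AU pU]; exists U => // x /(@cyl_take _ k)/pU. Qed.

Lemma exits_ex x : exists2 p, ~ small p & exits p x.
Proof.
have [oT _ _ _ _] := bT; have [_ oA' cA] := oA.
suff [[p bp px]|[p sp px]] : (exists2 p, ~ small p & core p x) \/ (exists2 p, small p &
  Cyl p x).
- by exists p => //; left.
- elim/last_ind: p sp px => // p i IH si ix.
  have [sp|bp] := pselect (small p); first exact: IH (cyl_sub ix).
  by exists p => //; right; exists i.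
have [[p cp]|inf] := cyl_core x.
  by have [sp|bp] := pselect (small p); [right; exists p => //; case: cp|left; exists p].
right; have : setT x by []. rewrite -cA => -[U AU Ux].
have /oT/(_ _ Ux)[n hn] := oA' _ AU; have [p px ph] := cyl_lim n inf.
by exists p => //; exists U => // y /ph/hn.
Qed.

Lemma exits_unique p q x : ~ small p -> ~ small q -> exits p x -> exits q x -> p = q.
Proof.
wlog pq : p q / (size p <= size q)%N.
  by move=> H; case/orP: (leq_total (size p) (size q)) => pq ? ? ? ?; [|apply/esym];
    exact: H.
move=> bp bq ep eq.
have cyl r : exits r x -> Cyl r x by move=> [[]|[i _ /cyl_sub]].
have pE := cyl_comparable pq (cyl _ ep) (cyl _ eq).
have [szE|lt] := leqP (size q) (size p); first by rewrite pE take_oversize.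
exfalso; have i0 : I by case: (q) lt.
have qx : Cyl (rcons p (nth i0 q (size p))) x.
  by rewrite [X in rcons X]pE -take_nth//; exact: cyl_take (cyl _ eq).
case: ep => [[_ /(_ _ qx)]//|[i si ix]].
apply: bq; apply: (@small_take _ (size p).+1).
by rewrite (take_nth i0)// -pE -(cyl_disj ix qx).
Qed.

(** Among the core points witnessing the attachments take the one of smallest
    radius: it is within the radius of all the others, hence lies in all the
    corresponding members of the cover of the core, which has the right order. *)
Lemma attached_card p q x : Cyl q x -> attached p q !=set0 ->
  attached p q #<= `I_N.+1.
Proof.
case: bT => oT rT sT lT [hm hT] qx att.
have H U : exists xn : T * nat, attached p q U ->
    [/\ D p U xn.1, (forall y, core p y -> V xn.2 xn.1 y -> D p U y) &
        V (h xn.2) xn.1 x].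
  have [[AU qU [y [n [Dy oy ny]]]]|nU] := pselect (attached p q U).
    by exists (y, n) => _; split=> //; exact: ny.
  by exists (x, 0%N).
have [f hf] := choice H.
have fin : finite_set (attached p q).
  by have [finA _ _] := oA; apply: sub_finite_set finA => U [].
have [W aW Wmax] := finite_argmax (fun U => (f U).2) fin att.
apply: card_le_trans (D_card p (f W).1); apply: subset_card_le => U aU.
have [AU _ _] := aU; split=> //; have [_ Uo Ux] := hf _ aU.
have [DW _ Wx] := hf _ aW; have [AW _ _] := aW.
apply: Uo; first by case: (D_sub AW DW).
apply: hT Ux _; apply: sT; apply: lT Wx; apply: hm; exact: Wmax.
Qed.

Lemma tree_cover_cover x : exists2 U, A U & tree_cover U x.
Proof.
have [p bp [cp|[i si ix]]] := exits_ex x.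
  by have [U AU DU] := D_cover cp; exists U => //; exists p; split=> //; left.
have [a0|/set0P[U aU]] := eqVneq (attached p (rcons p i)) set0.
  exists (holder (rcons p i)); first by case: (holderP si).
  by exists p; split=> //; right; exists i; split=> //; right.
exists U; first by case: aU.
by exists p; split=> //; right; exists i; split=> //; left.
Qed.

Lemma tree_cover_card x : [set U | A U /\ tree_cover U x] #<= `I_N.+1.
Proof.
have [p bp ep] := exits_ex x.
have uniq q : ~ small q -> exits q x -> q = p by move=> bq eq; exact: exits_unique eq ep.
have [cp|ncp] := pselect (core p x).
  apply: card_le_trans (D_card p x); apply: subset_card_le => U [AU [q [bq H]]].
  split=> //; case: H => [DU|[i [si ix _]]].
    by rewrite -(uniq q)//; left; case: (D_sub AU DU).
  have qp : q = p by apply: uniq => //; right; exists i.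
  by rewrite qp in ix; case: cp => _ /(_ i).
case: ep => [//|[i si ix]].
have sub : [set U | A U /\ tree_cover U x] `<=` assigned p (rcons p i).
  move=> U [AU [q [bq H]]]; case: H => [DU|[j [sj jx aj]]].
    have [cq _] := D_sub AU DU; exfalso; apply: ncp.
    by rewrite -(uniq q)//; left.
  have qp : q = p by apply: uniq => //; right; exists j.
  by rewrite qp in jx aj; rewrite (cyl_disj ix jx).
apply: card_le_trans (subset_card_le sub) _.
have [a0|/set0P an0] := eqVneq (attached p (rcons p i)) set0.
  apply: (@card_le_sub1 _ _ (holder (rcons p i))) => U.
  by rewrite /assigned a0 => -[|[]].
apply: card_le_trans (attached_card ix an0); apply: subset_card_le => U [//|[a0]].
by case: an0 => W; rewrite a0.
Qed.

End Cover.

(** A space split by a tree of open cylinders is no larger than its cores: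
    each core is covered by the dimension hypothesis, the branches accumulating on
    it are absorbed whole, and what remains of a finite cover is seen in finite
    depth along every infinite descent. *)
Lemma covering_dim_le_tree : covering_dim_le T N.
Proof.
apply/covering_dim_le_shrink => A oA; have [sm|big0] := pselect (small A [::]).
  have [U AU]:= sm; rewrite cyl0 => TU.
  exists (fun W => [set x | W = U]); split.
  - move=> W AW; split; last by move=> x /= ->; exact: TU.
    have [->|WU] := pselect (W = U).
      by rewrite (_ : [set _ | _] = setT); [exact: openT|apply/seteqP; split].
    by rewrite (_ : [set _ | _] = set0); [exact: open0|apply/seteqP; split].
  - by move=> x; exists U.
  - by move=> x; apply: (@card_le_sub1 _ _ U) => W [].
have [D hD] := choice (fun p => core_dim p oA).
have H p : exists U, small A p -> A U /\ Cyl p `<=` U.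
  by have [[U AU pU]|np] := pselect (small A p); [exists U|exists set0].
have [holder hholder] := choice H.
have D1 p U : A U -> D p U `<=` core p `&` U by case: (hD p) => + _ _ _; apply.
have D2 p U x : A U -> D p U x -> exists n, forall y, core p y -> V n x y -> D p U y.
  by case: (hD p) => _ + _ _; apply.
have D3 p x : core p x -> exists2 U, A U & D p U x by case: (hD p) => _ _ + _; apply.
have D4 p x : [set U | A U /\ D p U x] #<= `I_N.+1 by case: (hD p).
exists (tree_cover A D holder); split.
- by move=> U AU; split; [exact: tree_cover_open|exact: tree_cover_sub].
- exact: tree_cover_cover.
- exact: tree_cover_card.
Qed.

End Tree.

(** * The boundary of a piece inside the boundary of the space *)

Section RelDim.
Context {S T : topologicalType} {W : nat -> S -> S -> Prop}
  {V : nat -> T -> T -> Prop} {k h : nat -> nat}.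
Context (bS : uniform_base W k) (bT : uniform_base V h) (phi : S -> T).
Context (fwd : forall n, exists m, forall x y, W m x y -> V n (phi x) (phi y)).
Context (bwd : forall n, exists m, forall x y, V m (phi x) (phi y) -> W n x y).

(** A refinement of the traces is carried back to T; openness relative to the
    image is what the inverse control of the map gives. *)
Lemma rel_dim_le_embedding n : covering_dim_le S n -> rel_dim_le (V := V) n (range phi).
Proof.
move=> /covering_dim_le_shrink dS A [finA oA cA].
pose A' := (fun U => phi @^-1` U) @` A.
have [|D [oD cD cardD]] := dS A'.
  split; first exact: finite_image.
    by move=> _ [U AU <-]; exact: (embedding_continuous bS bT fwd (oA _ AU)).
  apply/seteqP; split=> // x _; have : setT (phi x) by []. rewrite -cA => -[U AU Ux].
  by exists (phi @^-1` U) => //; exists U.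
(* Several members of the cover may have the same trace; one of them is chosen
   to carry it. *)
have H B : exists U, A' B -> A U /\ phi @^-1` U = B.
  by have [[U AU <-]|nB] := pselect (A' B); [exists U|exists set0].
have [f hf] := choice H.
have [oS rS sS lS _] := bS; have [_ rT _ _ _] := bT.
have D_phi B x y : A' B -> D B x -> phi x = phi y -> D B y.
  move=> AB Dx xy; have /oS/(_ _ Dx)[m hm] := (oD _ AB).1; have [m' hm'] := bwd m.
  by apply: hm; apply: hm'; rewrite xy.
exists (fun U => [set z | exists B x, [/\ A' B, f B = U, D B x & phi x = z]]); split.
- move=> U AU z [B [x [AB <- Dx <-]]]; split; first by exists x.
  by have [_ fB] := hf _ AB; have := (oD _ AB).2 _ Dx; rewrite -{1}fB.
- move=> U z AU [B [x [AB fB Dx <-]]].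
  have /oS/(_ _ Dx)[m hm] := (oD _ AB).1; have [m' hm'] := bwd m.
  by exists m' => _ [y _ <-] /hm'/hm Dy; exists B, y.
- move=> _ [x _ <-]; have [B AB Dx] := cD x.
  by exists (f B); [exact: (hf _ AB).1|exists B, x].
- move=> z; have [[x _ <-]|nz] := pselect (range phi z); last first.
    apply: (@card_le_sub1 _ _ set0) => U [_ [B [x [_ _ _ xz]]]].
    by exfalso; apply: nz; exists x.
  apply: card_le_trans (cardD x).
  apply: card_le_trans (card_image_le f _); apply: subset_card_le.
  move=> U [AU [B [y [AB fB Dy yx]]]]; exists B => //; split=> //.
  exact: D_phi AB Dy yx.
Qed.

End RelDim.

Section Piece.
Context {R : realType} {X Z : metricType R} {EX CX E C : R}
  {gX : X -> X -> R -> X} {g : Z -> Z -> R -> Z}.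
Context (hX : coarsely_convex EX CX gX) (hZ : coarsely_convex E C g).
Context {eX : X} {e : Z} {i : X -> Z}.
Context (iso : forall x y, mdist (i x) (i y) = mdist x y)
  (geo : forall x y (t : R), 0 <= t <= 1 -> g (i x) (i y) t = i (gX x y t)).
Context (phi : boundary_pt EX CX gX eX -> boundary_pt E C g e)
  (hphi : induced_map i phi).

Lemma Sinfty_seq_close (u v : nat -> Z) : Sinfty E C g e u ->
  (forall T, seq_close (E := E) (C := C) (g := g) (e := e) T u v) ->
  Sinfty E C g e v.
Proof.
move=> /SinftyP Su uv; apply/SinftyP => T.
pose S := `|T| + 1; have S0 : 0 < S by have := normr_ge0 T; rewrite /S; lra.
have m1 := ultra_mult_ge1 (E := E) (C := C).
pose m : R := (ultra_mult E C)%:R.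
have mS0 : 0 < m * S by rewrite mulr_gt0// (lt_le_trans ltr01).
have mS : S <= m * S by rewrite ler_peMl// ltW.
have mmS : m * S <= m * (m * S) by rewrite ler_peMl// ltW.
have [N uN] := Su (m * (m * S)); have [M vM] := uv (m * (m * S)).
exists (maxn N M) => k l; rewrite !geq_max => /andP[Nk Mk] /andP[Nl Ml].
apply: (@lt_trans _ _ S%:E).
  by rewrite lte_fin /S; have := ler_norm T; lra.
have vk := vM _ Mk; rewrite gprod_sym in vk.
apply: (gprod_trans hZ S0 (gprod_trans hZ mS0 vk (uN _ _ Nk Nl))).
by apply: le_lt_trans (vM _ Ml); rewrite lee_fin.
Qed.

Context (P : set Z) {J : Type} (S : J -> set Z) (x : J -> X).
Context (P_cut : exists h, is_cut P h) (iP : forall y, P (i y))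
  (S_cut : forall j, is_cut (S j) (i (x j))) (iS : forall j y, ~ S j (i y))
  (eS : forall j, ~ S j e).
Context (P_cover : exists r : R, forall z, P z -> r < mdist e z ->
  (exists y, z = i y) \/ exists j, S j z).

Lemma induced_map_ends_in xi : ends_in P (phi xi) /\ forall j, ~ ends_in (S j) (phi xi).
Proof.
have [u xu] := rep_ex xi; split.
  have [h cP] := P_cut; apply: (ends_in1 hZ cP (hphi xu)).
  by exists 0%N => k _; exact: iP.
move=> j /(_ _ (hphi xu))[N /(_ N (leqnn _))]; exact: iS.
Qed.

(** The point h of a cut may be added to its side, so that gprod_cut_ge applies
    to h itself. *)
Lemma gprod_cut_gate j z (T : R) : S j z -> 0 <= T -> T < mdist e (i (x j)) ->
  (T%:E < gprod E C g e z (i (x j)))%E.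
Proof.
move=> Sz T0 Td; apply: (@lt_le_trans _ _ (mdist e (i (x j)))%:E);
  first by rewrite lte_fin.
apply: (gprod_cut_ge hZ (S := S j `|` [set i (x j)])); [|move=> []|by left|by right].
- move=> a b [Sa|->] nb; last by rewrite mdistxx add0r.
  by apply: S_cut => // Sb; apply: nb; left.
- exact: eS.
- by move=> /= ed; move: Td; rewrite ed mdistxx; lra.
Qed.

(** Let u represent xi and replace the terms lying in a branch S j by the point
    where the branch is attached. Since xi does not end in S j, some later term is
    on the other side of this cut while its product with u k is large; so the
    attaching point is far from the base point and its product with u k is large.
    The new sequence therefore represents xi as well, and it lies in the piece. *)
Lemma ends_in_induced_map xi : ends_in P xi -> (forall j, ~ ends_in (S j) xi) ->
  range phi xi.
Proof.
move=> Px nS; have [u xu] := rep_ex xi; have Su := rep_Sinfty xu.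
have [r hr] := P_cover; have [N1 uP] := Px _ xu.
have /SinftyP Su' := Su; have [N2 ur] := Su' r.
pose N0 := maxn N1 N2.
have H k : exists y, (N0 <= k)%N -> u k = i y \/ exists j, S j (u k) /\ y = x j.
  have [/[!geq_max] /andP[k1 k2]|lt] := leqP N0 k; last by exists eX.
  have [rk _] := gprod_dist (ur _ _ k2 k2).
  have [[y uy]|[j Sj]] := hr _ (uP _ k1) rk; first by exists y => _; left.
  by exists (x j) => _; right; exists j.
have [v hv] := choice H.
have uv T : seq_close (E := E) (C := C) (g := g) (e := e) T u (i \o v).
  pose T' := `|T| + slack E C + 1.
  have T'0 : 0 <= T' by have := slack_ge0 hZ; have := normr_ge0 T; rewrite /T'; lra.
  have TT' : T <= `|T| by exact: ler_norm.
  have sl := slack_ge0 hZ.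
  have [N3 uT] := Su' T'; exists (maxn N0 N3) => k; rewrite geq_max => /andP[k0 k3].
  have [uk|[j [Sj vk]]] := hv _ k0.
    rewrite /= -uk; apply: le_lt_trans (uT _ _ k3 k3); rewrite lee_fin /T'; lra.
  have [M hM] := ends_inC hZ (@S_cut j) (nS j) xu.
  have nSl := hM (maxn M N3) (leq_maxl _ _).
  have := gprod_cut_le hZ (@S_cut j) Sj nSl T'0 (uT _ _ k3 (leq_maxr _ _)).
  move=> T'd; apply: (@le_lt_trans _ _ (`|T|)%:E); first by rewrite lee_fin.
  rewrite /= vk; apply: (gprod_cut_gate Sj) => //.
  by move: T'd; rewrite /T'; lra.
have Siv := Sinfty_seq_close Su uv.
have [eta ev] := rep_mk ((Sinfty_transfer hX hZ eX e iso geo v).2 Siv).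
exists eta => //; apply: (rep_inj hZ (hphi ev)).
by apply: (rep_closed hZ xu Siv); apply/bequivP.
Qed.

End Piece.

(** * The tree structure of the free product *)

Section FreeProductTree.
Context {R : realType} {X Y : metricType R} {NX : net X} {NY : net Y}
  {oX : net_pts NX} {oY : net_pts NY}.
Local Notation fp := (free_product oX oY).
Local Notation W := (word oX oY).

(** The sequence of the edges to cross from the origin to a copy. Cylinders of
    sequences then give the tree structure. *)
Fixpoint addrX (v : wordX oX oY) : seq W :=
  match v with
  | emptyX => [::]
  | snocY v' b => rcons (addrY v') (wordy v' b)
  end
with addrY (v : wordY oX oY) : seq W :=
  match v with
  | emptyY => [:: @word0 _ _ _ _ _ _ _]
  | snocX v' a => rcons (addrX v') (wordx v' a)
  end.

Definition stem (w : W) : seq W :=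
  match w with word0 => [::] | wordx v _ => addrX v | wordy v _ => addrY v end.

Definition address (z : fp) : seq W :=
  match z with ptX v _ => addrX v | ptY v _ => addrY v | ptE w _ => rcons (stem w) w end.

Lemma address_foot w : address (foot w) = stem w. Proof. by case: w. Qed.

Lemma address_head w : address (Defs.head w) = rcons (stem w) w. Proof. by case: w. Qed.

Lemma address_edge w t : address (edge_pt w t) = if t <= 0 then stem w else rcons (stem
  w) w.
Proof.
rewrite /edge_pt; case: insubP => [t' /andP[t0 _] <-|_] /=.
  by rewrite leNgt; case: (t') => /= s /andP[-> _].
by case: ifP; rewrite ?address_foot ?address_head.
Qed.

(** The points whose address starts with p. For p ending in the edge w this is
    the part of the free product beyond the foot of w, including the open edge. *)
Definition cone (p : seq W) : set fp := [set z | take (size p) (address z) = p].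

Lemma cone0 : cone [::] = setT.
Proof. by apply/seteqP; split=> // z _; rewrite /cone /= take0. Qed.

Lemma cone_rcons p w : cone (rcons p w) `<=` cone p.
Proof.
move=> z; rewrite /cone /= => h.
have := congr1 (take (size p)) h; rewrite -take_min size_rcons.
by rewrite (minn_idPl (leqnSn _)) -cats1 take_size_cat.
Qed.

Lemma cone_disj p w w' z : cone (rcons p w) z -> cone (rcons p w') z -> w = w'.
Proof. by rewrite /cone /= !size_rcons => -> /rcons_inj[]. Qed.

Lemma cone_address z : cone (address z) z.
Proof. by rewrite /cone /= take_size. Qed.

Lemma cone_size p z : cone p z -> (size p <= size (address z))%N.
Proof. by rewrite /cone /= => <-; rewrite size_take_min geq_minr. Qed.

(** Every letter of an address is preceded by the address of its foot. *)
Definition well_stemmed (p : seq W) : Prop :=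
  forall q w, take (size q).+1 p = rcons q w -> q = stem w.

Lemma well_stemmed_rcons w : well_stemmed (stem w) -> well_stemmed (rcons (stem w) w).
Proof.
move=> H q w'; have [lt|le] := leqP (size q).+1 (size (stem w)).
  by rewrite -cats1 takel_cat//; exact: H.
by rewrite take_oversize ?size_rcons// => /rcons_inj[<- <-].
Qed.

Lemma well_stemmed_address z : well_stemmed (address z).
Proof.
have w0 : well_stemmed [::] by move=> [|? ?] ?.
have H : (forall v, well_stemmed (addrX v)) /\ (forall v, well_stemmed (addrY v)).
  split.
    apply: (@wordX_mut _ _ _ _ _ _ _ (fun v => well_stemmed (addrX v)) (fun v =>
      well_stemmed (addrY v))) => //=.
    - by move=> v ? b; exact: (@well_stemmed_rcons (wordy v b)).
    - exact: (@well_stemmed_rcons (@word0 _ _ _ _ _ _ _)).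
    - by move=> v ? a; exact: (@well_stemmed_rcons (wordx v a)).
  apply: (@wordY_mut _ _ _ _ _ _ _ (fun v => well_stemmed (addrX v)) (fun v =>
    well_stemmed (addrY v))) => //=.
  - by move=> v ? b; exact: (@well_stemmed_rcons (wordy v b)).
  - exact: (@well_stemmed_rcons (@word0 _ _ _ _ _ _ _)).
  - by move=> v ? a; exact: (@well_stemmed_rcons (wordx v a)).
case: z => [v x|v y|w t] /=; [exact: H.1|exact: H.2|].
by apply: well_stemmed_rcons; case: w => [|v a|v b]; [|exact: H.1|exact: H.2].
Qed.

Lemma cone_stem p w z : cone (rcons p w) z -> p = stem w.
Proof. by rewrite /cone /= size_rcons => /well_stemmed_address. Qed.

Lemma cone_next p z : cone p z -> address z = p \/ exists w, cone (rcons p w) z.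
Proof.
move=> pz; have := cone_size pz; rewrite leq_eqVlt => /predU1P[pe|lt].
  by left; rewrite -[RHS]pz pe take_size.
right; have [w0 _] : exists w : W, True by case: (address z) lt => // w *; exists w.
exists (nth w0 (address z) (size p)).
by rewrite /cone /= size_rcons (take_nth w0)// (pz : take _ _ = _).
Qed.

Lemma addrX_inj v v' : addrX v = addrX v' -> v = v'.
Proof.
case: v v' => [|v b] [|v' b'] //=; rewrite -?cats1; try by case: (addrY _).
by rewrite !cats1 => /rcons_inj[_ -> ->].
Qed.

Lemma addrY_inj v v' : addrY v = addrY v' -> v = v'.
Proof.
case: v v' => [|v a] [|v' a'] //=; rewrite -?(rcons_inj (s1 := [::])).
- by rewrite -[[:: _]]/(rcons [::] _) => /rcons_inj[].
- by rewrite -[[:: _]]/(rcons [::] _) => /rcons_inj[].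
- by move=> /rcons_inj[_ -> ->].
Qed.

Lemma addrXY v v' : addrX v = addrY v' -> False.
Proof.
case: v v' => [|v b] [|v' a'] /=; rewrite -?[[:: _]]/(rcons [::] _).
- by [].
- by case: (addrX v').
- by move=> /rcons_inj[].
- by move=> /rcons_inj[].
Qed.

Lemma stem_footX w v : stem w = addrX v -> exists x, foot w = ptX v x.
Proof.
case: w => [|v' a|v' b] /=; [|by move/addrX_inj ->; eexists|by move/esym/addrXY].
by move=> /(@addrX_inj (emptyX _ _)) <-; eexists.
Qed.

Lemma stem_footY w v : stem w = addrY v -> exists y, foot w = ptY v y.
Proof.
case: w => [|v' a|v' b] /=; [|by move/addrXY|by move/addrY_inj ->; eexists].
by move=> /(@addrXY (emptyX _ _)).
Qed.

Lemma seg_dist (s : segment oX oY) : mdist (seg_src s) (seg_tgt s) <= seg_len s.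
Proof.
have := @fp_dist_le _ _ _ _ _ _ _ (seg_src s) (seg_tgt s) [:: s] (conj erefl erefl).
by rewrite /chain_len big_seq1.
Qed.

Lemma cone_stem_rcons p w : p <> rcons (stem w) w ->
  take (size p) (stem w) = p <-> take (size p) (rcons (stem w) w) = p.
Proof.
move=> pw; have [le|lt] := leqP (size p) (size (stem w)).
  by rewrite -cats1 takel_cat.
split=> h; exfalso.
  by have := congr1 size h; rewrite take_oversize ?(ltnW lt)// => e; rewrite e ltnn in lt.
by apply: pw; rewrite -h take_oversize// size_rcons.
Qed.

Lemma seg_side p (s : segment oX oY) :
  (cone p (seg_src s) <-> cone p (seg_tgt s)) \/
  (exists w a b, s = segE w a b /\ p = rcons (stem w) w).
Proof.
case: s => [v x x'|v y y'|w a b]; [by left|by left|].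
have [pw|pw] := pselect (p = rcons (stem w) w); [by right; exists w, a, b|left].
have H := cone_stem_rcons pw; rewrite /cone /= !address_edge.
by case: ifP => _; case: ifP => _; rewrite ?H.
Qed.

Lemma edge_pt_foot (w : W) (a : {i01 R}) : a%:num <= 0 -> edge_pt w a%:num = foot w.
Proof.
move=> a0; have -> : a%:num = 0 by apply/le_anti; rewrite a0/=.
exact: edge_pt0.
Qed.

Lemma cone_edge (w : W) (a : R) : cone (rcons (stem w) w) (edge_pt w a) <-> 0 < a.
Proof.
rewrite /cone /= address_edge size_rcons; case: leP => a0; split=> //.
  by move=> /(congr1 size); rewrite size_rcons take_oversize// => /eqP; rewrite ltn_eqF.
by rewrite take_oversize// size_rcons.
Qed.

(** The signed distance to the foot, positive beyond it and negative before, is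
    1-Lipschitz on every segment, hence on chains, because a segment can only change
    side at the foot itself. *)
Lemma cone_cut w : is_cut (cone (rcons (stem w) w)) (foot w).
Proof.
move=> a b Sa Sb; apply/le_anti; rewrite metric_triangle /=.
pose S := cone (rcons (stem w) w).
pose f (z : fp) := if `[< S z >] then mdist z (foot w) else - mdist z (foot w).
suff fs s : `|f (seg_src s) - f (seg_tgt s)| <= seg_len s.
  have := @fp_dist_lip _ _ _ _ _ _ _ f a b fs; rewrite /f asboolT// asboolF//.
  by rewrite opprK (metric_sym b) => /(le_trans (ler_norm _)).
have same : (S (seg_src s) <-> S (seg_tgt s)) ->
  `|f (seg_src s) - f (seg_tgt s)| <= seg_len s.
  move=> e; have E : `[< S (seg_src s) >] = `[< S (seg_tgt s) >] by apply/asbool_equiv_eq.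
  apply: le_trans (seg_dist s); rewrite /f E; case: ifP => _.
    by rewrite !(metric_sym _ (foot w)) mdist_lip.
  by rewrite -opprD normrN !(metric_sym _ (foot w)) mdist_lip.
have [/same//|[w' [c [d [sE /rcons_inj[_ ww]]]]]] := seg_side (rcons (stem w) w) s.
rewrite sE -ww in same *.
have fE (t : R) : `[< S (edge_pt w t) >] = (0 < t).
  by apply/asboolP/idP; rewrite /S; [move/cone_edge|move=> t0; apply/cone_edge].
have flip : forall c d : {i01 R}, c%:num <= 0 -> 0 < d%:num ->
    `|f (edge_pt w c%:num) - f (edge_pt w d%:num)| <= `|c%:num - d%:num|.
  move=> c' d' c0 d0; have := seg_dist (segE w c' d').
  rewrite /f /= !fE d0 ltNge c0 /= (edge_pt_foot _ c0) mdistxx oppr0 sub0r normrN.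
  by rewrite metric_sym [X in _ -> X <= _]ger0_norm ?mdist_ge0.
have [c0|c0] := leP c%:num 0; have [d0|d0] := leP d%:num 0.
- by apply: same; rewrite /S /= !cone_edge !ltNge c0 d0.
- exact: flip.
- by rewrite /= distrC [X in _ <= X]distrC; exact: flip.
- by apply: same; rewrite /S /= !cone_edge c0 d0.
Qed.

(** The whole space and the empty set are cut by any point. *)
Lemma cone_is_cut p : exists h, is_cut (cone p) h.
Proof.
have z0 := ptX (emptyX oX oY) (net_base NX).
case/lastP: p => [|p w]; first by exists z0 => a b _; rewrite cone0 => nb; case: nb.
have [[z hz]|ne] := pselect (cone (rcons p w) !=set0).
  by rewrite (cone_stem hz); exists (foot w); exact: cone_cut.
by exists z0 => a b ha; case: ne; exists a.
Qed.

Definition origin : fp := ptX (emptyX oX oY) (net_base NX).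

(** The number of edges crossed, interpolated along the edges, is 1-Lipschitz. *)
Lemma depth_le_dist w : (size (stem w))%:R <= mdist origin (foot w).
Proof.
pose fX (v : wordX oX oY) (x : X) : R := (size (addrX v))%:R.
pose fY (v : wordY oX oY) (y : Y) : R := (size (addrY v))%:R.
pose fE (w : W) (t : R) := (size (stem w))%:R + t.
have := @fp_fun_lip _ _ _ _ _ _ _ fX fY fE origin (foot w).
have -> : fp_fun fX fY fE origin = 0 by [].
have -> : fp_fun fX fY fE (foot w) = (size (stem w))%:R by case: (w).
rewrite sub0r normrN ger0_norm//; apply.
- by move=> v x x'; rewrite subrr normr0 mdist_ge0.
- by move=> v y y'; rewrite subrr normr0 mdist_ge0.
- by move=> u s t _ _; rewrite /fE opprD addrACA subrr add0r.
- by move=> u; rewrite /fE addr0; case: u.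
- by move=> u; rewrite /fE; case: u => [|? ?|? ?];
  rewrite /= /fX /fY /= ?size_rcons ?natr1 ?add0r.
Qed.

Lemma edge_near w (t : {t : R | 0 < t < 1}) : mdist origin (ptE w t :
  fp) <= mdist origin (foot w) + 1.
Proof.
apply: le_trans (metric_triangle _ (foot w) _) _; rewrite lerD2l.
case: t => t t01; have /andP[t0 t1] := t01.
have t01' : 0 <= t <= 1 by rewrite !ltW.
pose i0 : {i01 R} := Itv01 (lexx 0) ler01.
have d : mdist (edge_pt w 0) (edge_pt w t) <= `|0 - t| :=
  seg_dist (segE w i0 (Itv01 (andP t01').1 (andP t01').2)).
move: d; rewrite edge_pt0 (edge_ptE w (exist _ t t01)) sub0r normrN ger0_norm;
  last exact: ltW.
by move=> /le_trans; apply; exact: ltW.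
Qed.

End FreeProductTree.

(** * Projections to the pieces *)

Section FreeProductGeodesics.
Context {R : realType} {X Y : metricType R} {NX : net X} {NY : net Y}
  {oX : net_pts NX} {oY : net_pts NY}.
Local Notation fp := (free_product oX oY).
Local Notation W := (word oX oY).

Section Projection.
Context (p : seq W) (Q : set fp) (b : fp).
Context (Q_address : forall z, Q z -> address z = p)
  (Q_foot : forall w, stem w = p -> Q (foot w))
  (Q_edge : forall w (a : {i01 R}), 0 < a%:num -> Q (edge_pt w a%:num) ->
     edge_pt w a%:num = b).

(** The entrance by which z is seen from the piece Q of address p: z itself if it
    lies in Q, or the foot of the edge leaving Q towards z. *)
Definition gate (z : fp) : set fp :=
  [set z' | Q z /\ z' = z \/ exists2 w, cone (rcons p w) z & z' = foot w].

(** The points having no gate are those seen through the entrance b of the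
    piece. *)
Definition proj (z : fp) : fp := xget b (gate z).

Lemma cone_notin w z : cone (rcons p w) z -> ~ Q z.
Proof. by move=> /cone_size le /Q_address e; move: le; rewrite e size_rcons ltnn. Qed.

Lemma proj_gate z z' : gate z z' -> proj z = z'.
Proof.
move=> g; rewrite /proj; case: xgetP => [y _ g'|/(_ z')//].
case: g g' => [[Qz ->]|[w wz ->]] [[Qz' ->]|[w' wz' ->]] //.
- by case: (cone_notin wz').
- by case: (cone_notin wz).
- by rewrite (cone_disj wz wz').
Qed.

Lemma proj_in z : Q z -> proj z = z.
Proof. by move=> Qz; apply: proj_gate; left. Qed.

Lemma proj_same z1 z2 : ~ Q z1 -> ~ Q z2 ->
  (forall w, cone (rcons p w) z1 <-> cone (rcons p w) z2) -> proj z1 = proj z2.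
Proof.
move=> Q1 Q2 c; congr xget; apply/seteqP; split=> z [[]//|[w wz ->]];
  by right; exists w => //; apply/c.
Qed.

Lemma proj_edge w (a : {i01 R}) : proj (edge_pt w a%:num) = proj (foot w).
Proof.
have [a0|a0] := leP a%:num 0; first by rewrite edge_pt_foot.
have ew : address (edge_pt w a%:num) = rcons (stem w) w by rewrite address_edge leNgt a0.
have [sp|sp] := pselect (stem w = p).
  rewrite (proj_in (Q_foot sp)); apply: proj_gate; right; exists w => //.
  by rewrite -sp; apply/cone_edge.
have Qf : ~ Q (foot w) by move=> /Q_address; rewrite address_foot.
have [Qz|Qz] := pselect (Q (edge_pt w a%:num)).
  rewrite (proj_in Qz) (Q_edge a0 Qz) /proj; case: xgetP => // y _ [[]//|[w' /cone_size]].
  by rewrite size_rcons address_foot -(Q_address Qz) ew size_rcons ltnNge leqW.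
apply: proj_same => // w'; rewrite /cone /= ew address_foot.
by rewrite -cone_stem_rcons// => /rcons_inj[/esym].
Qed.

End Projection.

Lemma edge_pt_gt0 w (a : {i01 R}) : 0 < a%:num ->
  edge_pt w a%:num = Defs.head w \/ exists t, edge_pt w a%:num = ptE w t :> fp.
Proof.
move=> a0; rewrite /edge_pt; case: insubP => [t _ _|_]; first by right; exists t.
by left; rewrite leNgt a0.
Qed.

Definition projX v : fp -> fp := proj (addrX v) (range (ptX v)) (ptX v (net_base NX)).
Definition projY v : fp -> fp := proj (addrY v) (range (ptY v)) (ptY v (net_base NY)).

Lemma projX_pt v x : projX v (ptX v x) = ptX v x.
Proof. by apply: proj_in; [move=> _ [? _ <-]|exists x]. Qed.

Lemma projY_pt v y : projY v (ptY v y) = ptY v y.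
Proof. by apply: proj_in; [move=> _ [? _ <-]|exists y]. Qed.

(** The pieces are arranged in a tree: any other piece is seen from a given copy
    through a single point. *)
Lemma projX_seg v s : seg_piece s <> copyX v ->
  projX v (seg_src s) = projX v (seg_tgt s).
Proof.
case: s => [v' x x' /= vv|v' y y' _|w a b _] /=.
- by apply: proj_same => // -[z _ [ve _]]; apply: vv; rewrite ve.
- by apply: proj_same => // -[].
- rewrite /projX !proj_edge//; try by move=> _ [? _ <-].
  + by move=> u /stem_footX[x ->]; exists x.
  + move=> u c /(@edge_pt_gt0 u)[->|[t ->]] [x _] //.
    by case: u => [|? ?|? ?] //= -[->].
  + by move=> u /stem_footX[x ->]; exists x.
  + move=> u c /(@edge_pt_gt0 u)[->|[t ->]] [x _] //.
    by case: u => [|? ?|? ?] //= -[->].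
Qed.

Lemma projY_seg v s : seg_piece s <> copyY v ->
  projY v (seg_src s) = projY v (seg_tgt s).
Proof.
case: s => [v' x x' _|v' y y' /= vv|w a b _] /=.
- by apply: proj_same => // -[].
- by apply: proj_same => // -[z _ [ve _]]; apply: vv; rewrite ve.
- rewrite /projY !proj_edge//; try by move=> _ [? _ <-].
  + by move=> u /stem_footY[x ->]; exists x.
  + move=> u c /(@edge_pt_gt0 u)[->|[t ->]] [x _] //.
    by case: u => [|? ?|? ?] //= -[->].
  + by move=> u /stem_footY[x ->]; exists x.
  + move=> u c /(@edge_pt_gt0 u)[->|[t ->]] [x _] //.
    by case: u => [|? ?|? ?] //= -[->].
Qed.

Definition projE (w : W) (z : fp) : R :=
  if `[< cone (rcons (stem w) w) z >] then
    if z is ptE w' t then if `[< w' = w >] then val t else 1 else 1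
  else 0.

Lemma projE_pt w (a : {i01 R}) : projE w (edge_pt w a%:num) = a%:num.
Proof.
rewrite /projE; have [a0|a0] := leP a%:num 0.
  rewrite asboolF; last by move=> /cone_edge; rewrite ltNge a0.
  by apply/le_anti; rewrite a0 andbT.
rewrite asboolT; last exact/cone_edge.
rewrite /edge_pt; case: insubP => [t _ ta|]; first by rewrite asboolT.
move=> /negP n; have -> : a%:num = 1.
  apply/le_anti/andP; split=> //; rewrite leNgt; apply/negP => a1.
  by apply: n; apply/andP; split.
rewrite leNgt ltr01 /=.
by case: w.
Qed.

Lemma projE_seg w s : seg_piece s <> edge w -> projE w (seg_src s) = projE w (seg_tgt s).
Proof.
move=> sw; have [e|[w' [a [b [sE /rcons_inj[_ ww]]]]]] :=
  seg_side (rcons (stem w) w) s; last first.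
  by rewrite sE ww in sw.
rewrite /projE (asbool_equiv_eq e); case: ifP => // _.
case: s sw {e} => [v x x'|v y y'|w' a b] //= sw.
have one c : match edge_pt w' c with ptE w0 t =>
  if `[< w0 = w >] then val t else 1 | _ => 1 end = 1.
  rewrite /edge_pt; case: insubP => [t _ _|_].
    by rewrite asboolF// => ww; apply: sw; rewrite ww.
  by case: ifP => _; case: w' {sw}.
by rewrite !one.
Qed.

Lemma chain_const (U : Type) (F : fp -> U) (P : piece oX oY) p q l :
  (forall s, seg_piece s <> P -> F (seg_src s) = F (seg_tgt s)) ->
  (forall s, s \in l -> seg_piece s <> P) -> is_chain p q l -> F p = F q.
Proof.
move=> FP; elim: l p => [|s l IH] p lP /=; first by move=> ->.
move=> [<- c]; rewrite FP; last by apply: lP; rewrite mem_head.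
by apply: IH => // s' sl; apply: lP; rewrite in_cons sl orbT.
Qed.

Lemma chain_split (p q : fp) l l' : is_chain p q (l ++ l') ->
  exists2 r, is_chain p r l & is_chain r q l'.
Proof.
elim: l p => [|s l IH] p /=; first by exists p.
by move=> [sp /IH[r]]; exists r.
Qed.

(** A map collapsing all the pieces but one only changes along the single
    segment of that piece in a reduced chain. *)
Lemma chain_visit (U : Type) (F : fp -> U) p q l (s : segment oX oY) :
  (forall s', seg_piece s' <> seg_piece s -> F (seg_src s') = F (seg_tgt s')) ->
  is_reduced_chain p q l -> s \in l -> F p = F (seg_src s) /\ F (seg_tgt s) = F q.
Proof.
move=> FP [c pw] /splitPr sl; case: sl c pw => l1 l2 c.
rewrite pairwise_map pairwise_cat /= => /and3P[/allrelP r1 _ /andP[/allP r2 _]].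
have [r c1 /= [sr c2]] := chain_split c; rewrite -sr in c1; split.
  apply: chain_const FP _ c1 => s' sl1.
  by have /asboolP := r1 _ _ sl1 (mem_head _ _).
apply: chain_const FP _ c2 => s' sl2 e.
by have /asboolP := r2 _ sl2; apply.
Qed.

End FreeProductGeodesics.

(** * Bicombing geodesics inside a copy *)

Section FreeProductCopies.
Context {R : realType} {X Y : metricType R} {NX : net X} {NY : net Y}
  {oX : net_pts NX} {oY : net_pts NY}.
Local Notation fp := (free_product oX oY).
Local Notation seg := (segment oX oY).
Implicit Types (s : seg) (p q : fp) (l : seq seg).

(** The projection to the copy does not increase the length of the segments, so
    that leaving the copy is no shortcut. *)
Lemma ptX_dist (v : wordX oX oY) x x' : mdist (ptX v x) (ptX v x') = mdist x x'.
Proof.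
apply/le_anti; rewrite (seg_dist (segX v x x')) /=.
pose f z := if projX v z is ptX _ y then mdist x y else 0.
have := @fp_dist_lip _ _ _ _ _ _ _ f (ptX v x) (ptX v x').
rewrite /f !projX_pt mdistxx sub0r normrN ger0_norm ?mdist_ge0//; apply => s.
have [|sv] := pselect (seg_piece s = copyX v); last first.
  by rewrite projX_seg// subrr normr0 seg_len_ge0.
by case: s => // v' y y' [->] /=; rewrite !projX_pt mdist_lip.
Qed.

Lemma ptY_dist (v : wordY oX oY) y y' : mdist (ptY v y) (ptY v y') = mdist y y'.
Proof.
apply/le_anti; rewrite (seg_dist (segY v y y')) /=.
pose f z := if projY v z is ptY _ x then mdist y x else 0.
have := @fp_dist_lip _ _ _ _ _ _ _ f (ptY v y) (ptY v y').
rewrite /f !projY_pt mdistxx sub0r normrN ger0_norm ?mdist_ge0//; apply => s.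
have [|sv] := pselect (seg_piece s = copyY v); last first.
  by rewrite projY_seg// subrr normr0 seg_len_ge0.
by case: s => // v' x x' [->] /=; rewrite !projY_pt mdist_lip.
Qed.

Definition degenerate s : Prop := seg_src s = seg_tgt s /\ seg_len s = 0.

(** The segment s0 itself collapses under the projection to the piece of s,
    so its two endpoints have the same projection; by chain_visit the endpoints of s
    have this projection too. *)
Lemma reduced_degenerate s0 l s : is_reduced_chain (seg_src s0) (seg_tgt s0) l ->
  s \in l -> seg_piece s <> seg_piece s0 -> degenerate s.
Proof.
move=> red sl ne; rewrite /degenerate.
have ne' : seg_piece s0 <> seg_piece s by move=> e; apply: ne.
have collapse (U : Type) (F : fp -> U) :
    (forall s', seg_piece s' <> seg_piece s -> F (seg_src s') = F (seg_tgt s')) ->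
    F (seg_src s) = F (seg_tgt s).
  by move=> FP; have [<- ->] := chain_visit FP red sl; exact: FP.
case: s sl {ne ne'} collapse => [v x x'|v y y'|w a b] _ /= H.
- have := H _ _ (@projX_seg _ _ _ _ _ _ _ v); rewrite !projX_pt => -[->].
  by rewrite mdistxx.
- have := H _ _ (@projY_seg _ _ _ _ _ _ _ v); rewrite !projY_pt => -[->].
  by rewrite mdistxx.
- have := H _ _ (@projE_seg _ _ _ _ _ _ _ w); rewrite !projE_pt => ->.
  by rewrite subrr normr0.
Qed.

Lemma reduced_copyX (v : wordX oX oY) x x' l s :
  is_reduced_chain (ptX v x) (ptX v x') l ->
  s \in l -> seg_piece s = copyX v -> s = segX v x x'.
Proof.
move=> red sl; case: s sl => [v' a b|//|//] sl /= [e]; move: sl; rewrite e => sl.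
have [] := chain_visit (s := segX v a b) (@projX_seg _ _ _ _ _ _ _ v) red sl.
by rewrite !projX_pt => -[->] [->].
Qed.

Lemma reduced_copyY (v : wordY oX oY) y y' l s :
  is_reduced_chain (ptY v y) (ptY v y') l ->
  s \in l -> seg_piece s = copyY v -> s = segY v y y'.
Proof.
move=> red sl; case: s sl => [//|v' a b|//] sl /= [e]; move: sl; rewrite e => sl.
have [] := chain_visit (s := segY v a b) (@projY_seg _ _ _ _ _ _ _ v) red sl.
by rewrite !projY_pt => -[->] [->].
Qed.

Context {gX : X -> X -> R -> X} {gY : Y -> Y -> R -> Y}.
Context (hX : geodesic_bicombing gX) (hY : geodesic_bicombing gY).

Lemma seg_at0 s : seg_at gX gY s 0 = seg_src s.
Proof.
case: s => [v x x'|v y y'|w a b] /=.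
- by have [-> _ _] := hX x x'.
- by have [-> _ _] := hY y y'.
- by rewrite subr0 mul1r mul0r addr0.
Qed.

Lemma chain_len_degenerate l : (forall s, s \in l -> degenerate s) -> chain_len l = 0.
Proof. by move=> H; rewrite /chain_len big_seq big1// => s /H[]. Qed.

Lemma walk0 p q l : is_chain p q l -> walk gX gY p l 0 = p.
Proof.
case: l => [//|s l] /= [<- _]; rewrite seg_len_ge0 mul0r; exact: seg_at0.
Qed.

(** A reduced chain joining the endpoints of s0 is s0 up to segments of length
    0, on which the walk spends no time. *)
Lemma walk_reduced s0 l t : 0 <= t <= 1 -> 0 < seg_len s0 ->
  seg_src s0 <> seg_tgt s0 ->
  (forall s, s \in l -> degenerate s \/ s = s0) ->
  is_reduced_chain (seg_src s0) (seg_tgt s0) l ->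
  walk gX gY (seg_src s0) l (t * chain_len l) = seg_at gX gY s0 t.
Proof.
move=> /andP[t0 t1] s0p ne; elim: l => [|s l IH] lP; first by move=> [].
move=> [/= [ss c] /andP[al pw]].
have cl : chain_len (s :: l) = seg_len s + chain_len l by rewrite /chain_len big_cons.
have [[st sl]|sE] := lP _ (mem_head _ _).
  rewrite cl sl add0r; have lP' s' : s' \in l -> degenerate s' \/ s' = s0.
    by move=> s'l; apply: lP; rewrite in_cons s'l orbT.
  rewrite -st ss in c *.
  have [le|lt] := leP; last by rewrite subr0; apply: IH.
  have tl : t * chain_len l = 0.
    by apply/le_anti; rewrite le mulr_ge0// chain_len_ge0.
  by rewrite tl mul0r seg_at0 ss -(IH lP' (conj c pw)) tl (walk0 c).
have l0 : chain_len l = 0.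
  apply: chain_len_degenerate => s' s'l.
  have s'l2 : s' \in s :: l by rewrite in_cons s'l orbT.
  have [//|s'E] := lP _ s'l2.
  move: al; rewrite all_map => /allP/(_ _ s'l)/asboolP /=.
  by rewrite s'E sE.
rewrite cl l0 addr0 sE ler_piMl ?seg_len_ge0//.
by rewrite mulfK// gt_eqF.
Qed.

Lemma reduced_chainP p q l0 : is_reduced_chain p q l0 ->
  is_reduced_chain p q (reduced_chain p q).
Proof. by move=> h; apply: xgetPex; exists l0. Qed.

Lemma fp_bicombing_seg s0 t : 0 <= t <= 1 ->
  mdist (seg_src s0) (seg_tgt s0) = seg_len s0 ->
  (seg_len s0 = 0 -> seg_at gX gY s0 t = seg_src s0) ->
  (forall l s, is_reduced_chain (seg_src s0) (seg_tgt s0) l -> s \in l ->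
    seg_piece s = seg_piece s0 -> s = s0) ->
  fp_bicombing gX gY (seg_src s0) (seg_tgt s0) t = seg_at gX gY s0 t.
Proof.
move=> t01 d s00 uniq; rewrite /fp_bicombing.
have red : is_reduced_chain (seg_src s0) (seg_tgt s0) (reduced_chain (seg_src s0)
  (seg_tgt s0)).
  by apply: (@reduced_chainP _ _ [:: s0]).
set l := reduced_chain _ _ in red *.
have lP s : s \in l -> degenerate s \/ s = s0.
  move=> sl; have [e|ne] := pselect (seg_piece s = seg_piece s0).
    by right; exact: uniq red sl e.
  by left; exact: reduced_degenerate red sl ne.
have := seg_len_ge0 s0; rewrite le_eqVlt => /predU1P[z|pos].
  have -> : chain_len l = 0.
    by rewrite /chain_len big_seq big1// => s /lP[[]//|->].
  by rewrite mulr0 s00// (walk0 red.1).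
apply: walk_reduced => // e; move: pos; rewrite -d e mdistxx ltxx//.
Qed.

Lemma fp_bicombing_ptX (v : wordX oX oY) x x' t : 0 <= t <= 1 ->
  fp_bicombing gX gY (ptX v x) (ptX v x') t = ptX v (gX x x' t).
Proof.
move=> t01; apply: (@fp_bicombing_seg (segX v x x')) => //=.
- exact: ptX_dist.
- move=> /mdist_positivity <-; congr (ptX v _); have [g0 _ gd] := hX x x.
  by apply: mdist_positivity; rewrite -[X in mdist _ X]g0 gd// ?lexx ?ler01// mdistxx
    mulr0.
- by move=> l s; exact: reduced_copyX.
Qed.

Lemma fp_bicombing_ptY (v : wordY oX oY) y y' t : 0 <= t <= 1 ->
  fp_bicombing gX gY (ptY v y) (ptY v y') t = ptY v (gY y y' t).
Proof.
move=> t01; apply: (@fp_bicombing_seg (segY v y y')) => //=.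
- exact: ptY_dist.
- move=> /mdist_positivity <-; congr (ptY v _); have [g0 _ gd] := hY y y.
  by apply: mdist_positivity; rewrite -[X in mdist _ X]g0 gd// ?lexx ?ler01// mdistxx
    mulr0.
- by move=> l s; exact: reduced_copyY.
Qed.

End FreeProductCopies.

(** * The boundary of the free product *)

(** The identity induces a bijection of the boundaries taken at two base
    points, continuous in both directions. *)
Lemma covering_dim_le_base (R : realType) (Z : metricType R) (E C : R)
    (g : Z -> Z -> R -> Z) (e1 e2 : Z) n : coarsely_convex E C g ->
  covering_dim_le (boundary E C g e1) n -> covering_dim_le (boundary E C g e2) n.
Proof.
move=> hg; have iso (x y : Z) : mdist (idfun x) (idfun y) = mdist x y by [].
have geo x y (t : R) : 0 <= t <= 1 -> g (idfun x) (idfun y) t = idfun (g x y t) by [].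
have [phi hphi] := induced_map_ex hg hg e2 e1 iso geo.
apply: (covering_dim_le_embedding (boundary_base hg) (boundary_base hg)
  (induced_map_near hg hg iso geo hphi) (induced_map_near_inv hg hg iso geo hphi)).
suff -> : ~` range phi = set0 by exact: open0.
apply/seteqP; split=> // eta; apply.
have [u eu] := rep_ex eta.
have Su := (Sinfty_transfer hg hg e2 e1 iso geo u).2 (rep_Sinfty eu).
have [xi xu] := rep_mk Su; exists xi => //.
exact: (rep_inj hg (hphi _ _ xu)).
Qed.

Section BoundaryOfFreeProduct.
Context {R : realType} {X Y : metricType R} {EX CX : R} {gX : X -> X -> R -> X}
  {EY CY : R} {gY : Y -> Y -> R -> Y} {NX : net X} {NY : net Y}
  {oX : net_pts NX} {oY : net_pts NY} {E C : R} {eX : X} {eY : Y}.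
Context (hX : coarsely_convex EX CX gX) (hY : coarsely_convex EY CY gY)
  (hXY : coarsely_convex E C (fp_bicombing (oX := oX) (oY := oY) gX gY)).
Local Notation fp := (free_product oX oY).
Local Notation W := (word oX oY).
Local Notation g := (fp_bicombing (oX := oX) (oY := oY) gX gY).
Local Notation origin := (origin (oX := oX) (oY := oY)).
Local Notation bd := (boundary E C g origin).

Definition cylinder (p : seq W) : set bd := ends_in (E := E) (C := C) (g := g) (e :=
  origin) (cone p).

Lemma cylinder0 : cylinder [::] = setT.
Proof.
by apply/seteqP; split=> // xi _ u _; rewrite cone0; exists 0%N.
Qed.

Lemma cylinder_rcons p w : cylinder (rcons p w) `<=` cylinder p.
Proof. exact/ends_in_sub/cone_rcons. Qed.

Lemma cylinder_disj p w w' xi : cylinder (rcons p w) xi ->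
  cylinder (rcons p w') xi -> w = w'.
Proof.
move=> h h'; apply: contrapT => ww; apply: ends_in_disj h h' => z wz wz'.
by apply: ww; exact: cone_disj wz wz'.
Qed.

Lemma cylinder_open p : open (cylinder p).
Proof.
apply/(boundary_open hXY) => xi px; have [h ch] := cone_is_cut p.
by have [n hn] := ends_in_bdry_near hXY ch (e := origin); exists n => eta /hn; apply.
Qed.

Lemma cylinder_closed p : open (~` cylinder p).
Proof.
apply/(boundary_open hXY) => xi px; have [h ch] := cone_is_cut p.
have [n hn] := ends_in_bdry_near hXY ch (e := origin); exists n => eta xe pe; apply: px.
by apply: hn pe; exact: bdry_near_sym.
Qed.

Lemma core_cylinder_closed p : open (~` core cylinder p).
Proof.
rewrite (_ : ~` _ = ~` cylinder p `|` \bigcup_w cylinder (rcons p w)).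
  by apply: openU; [exact: cylinder_closed|apply: bigcup_open => w _;
    exact: cylinder_open].
apply/seteqP; split=> [xi nc|xi [np [px _]//|[w _ wx] [_ /(_ w)]//]].
have [px|px] := pselect (cylinder p xi); [right|by left].
apply: contrapT => nw; apply: nc; split=> // w wx; apply: nw.
by exists w.
Qed.

Lemma cylinder_cone p xi : cylinder p xi -> cone p !=set0.
Proof.
by move=> px; have [u xu] := rep_ex xi; have [N /(_ N (leqnn _))] := px _ xu;
  exists (u N).
Qed.

Lemma cylinder_cut p w xi : cylinder (rcons p w) xi ->
  p = stem w /\ is_cut (cone (rcons p w)) (foot w).
Proof.
by move=> /cylinder_cone[z wz]; rewrite (cone_stem wz); split=> //; exact: cone_cut.
Qed.

Lemma origin_notin p w : ~ cone (rcons p w) origin.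
Proof. by move=> /cone_size; rewrite size_rcons. Qed.

(** A boundary point of the branch w close to xi, which is not in this branch,
    forces the foot of w to be far from the origin; then the whole branch is close to
    it. *)
Lemma cylinder_shrink p xi n : core cylinder p xi -> exists m, forall w eta zeta,
  cylinder (rcons p w) eta -> cylinder (rcons p w) zeta -> bdry_near m xi eta ->
    bdry_near n xi zeta.
Proof.
move=> [px nx]; pose b := bdry_half E C n; pose c := (Num.trunc (slack E C)).+1.
exists (b + c)%N => w eta zeta we wz /bdry_near_pt_close xe.
have [_ cw] := cylinder_cut we.
have xe' : pt_close (b + c).+1%:R (inr xi) (inr eta) by exact: xe.
apply: (@bdry_half_trans _ _ _ _ _ _ hXY n _ (inr eta)).
  by apply: pt_close_le xe; rewrite ler_nat leqW// leq_addr.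
apply: (cut_close hXY cw (@origin_notin p w)) => //.
have /(_ we (nx w)) := cut_far hXY cw (ler0n _ _) (pt_close_sym xe').
have sc : slack E C < c%:R by exact: truncnS_gt.
by rewrite /cut_bound -natr1 natrD; lra.
Qed.

(** Each edge has length 1, so that the feet of the edges crossed by an infinite
    word go to infinity. *)
Lemma cylinder_lim xi n : (forall k, exists2 p, size p = k & cylinder p xi) ->
  exists2 p, cylinder p xi & forall eta, cylinder p eta -> bdry_near n xi eta.
Proof.
move=> /(_ n.+4)[p szp px]; exists p => // eta; case/lastP: p szp px => // p w.
rewrite size_rcons => -[szp] wx we; have [pw cw] := cylinder_cut wx.
apply: (@pt_close_bdry_near _ _ _ _ _ _ _ n.+2%:R); first by rewrite ltr_nat.
apply: (cut_close hXY cw (@origin_notin p w)) => //.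
by apply: lt_le_trans (depth_le_dist w); rewrite -pw szp ltr_nat.
Qed.

Lemma cone_nonempty p : cone p !=set0 ->
  (exists v : wordX oX oY, p = addrX v) \/ exists v : wordY oX oY, p = addrY v.
Proof.
case/lastP: p => [_|p w [z wz]]; first by left; exists (emptyX _ _).
rewrite (cone_stem wz) -address_head.
by case: w {wz} => [|v a|v b]; [right|right|left]; eexists.
Qed.

Let phiX_ex (v : wordX oX oY) :=
  induced_map_ex hX hXY eX origin (ptX_dist v) (fp_bicombing_ptX
    (coarsely_convex_bicombing hX) (coarsely_convex_bicombing hY) v).
Let phiY_ex (v : wordY oX oY) :=
  induced_map_ex hY hXY eY origin (ptY_dist v) (fp_bicombing_ptY
    (coarsely_convex_bicombing hX) (coarsely_convex_bicombing hY) v).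

(** Inside a copy, the boundary points that enter no further branch are those of
    the copy. The edge leading to the copy has the same address as the copy, but it
    is bounded. *)
Lemma core_addrX v phi :
  induced_map (EX := EX) (CX := CX) (E := E) (C := C) (gX := gX) (g := g) (eX :=
    eX) (e := origin) (ptX v) phi ->
  core cylinder (addrX v) = range phi.
Proof.
move=> hphi; have H w : exists x, stem w = addrX v -> foot w = ptX v x.
  have [/stem_footX[x ->]|] := pselect (stem w = addrX v); first by exists x.
  by exists (net_base NX).
have [x hx] := choice H.
have P_cut := cone_is_cut (addrX v).
have iP y : cone (addrX v) (ptX v y) by exact: (cone_address (ptX v y)).
have S_cut w : is_cut (cone (rcons (addrX v) w)) (ptX v (x w)).
  move=> a b aw; have sw := cone_stem aw; rewrite -(hx w (esym sw)).
  by move: aw; rewrite sw; exact: cone_cut.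
have iS w y : ~ cone (rcons (addrX v) w) (ptX v y).
  by move=> /cone_size; rewrite size_rcons ltnn.
have P_cover : exists r : R, forall z, cone (addrX v) z -> r < mdist origin z ->
    (exists y, z = ptX v y) \/ exists w, cone (rcons (addrX v) w) z.
  exists (if v is snocY v' b then mdist origin (foot (wordy v' b)) + 1 else 0) => z vz rz.
  have [zv|] := cone_next vz; last by right.
  left; case: z vz rz zv => [v' y|v' y|w t] vz rz /=.
  - by move=> /addrX_inj <-; exists y.
  - by move=> /esym/addrXY.
  - case: (v) rz => [|v' b] rz /=; first by case: (stem w).
    by move=> /rcons_inj[_ we]; move: rz; rewrite we ltNge edge_near.
apply/seteqP; split=> [xi [px nx]|_ [xi _ <-]].
  exact: (ends_in_induced_map hX hXY (ptX_dist v) (fp_bicombing_ptX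
    (coarsely_convex_bicombing hX) (coarsely_convex_bicombing hY) v) hphi
    S_cut (@origin_notin _) P_cover px nx).
exact: (induced_map_ends_in hXY hphi P_cut iP iS xi).
Qed.

Lemma core_addrY v phi :
  induced_map (EX := EY) (CX := CY) (E := E) (C := C) (gX := gY) (g := g) (eX :=
    eY) (e := origin) (ptY v) phi ->
  core cylinder (addrY v) = range phi.
Proof.
move=> hphi; have H w : exists y, stem w = addrY v -> foot w = ptY v y.
  have [/stem_footY[y ->]|] := pselect (stem w = addrY v); first by exists y.
  by exists (net_base NY).
have [y hy] := choice H.
have P_cut := cone_is_cut (addrY v).
have iP x : cone (addrY v) (ptY v x) by exact: (cone_address (ptY v x)).
have S_cut w : is_cut (cone (rcons (addrY v) w)) (ptY v (y w)).
  move=> a b aw; have sw := cone_stem aw; rewrite -(hy w (esym sw)).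
  by move: aw; rewrite sw; exact: cone_cut.
have iS w x : ~ cone (rcons (addrY v) w) (ptY v x).
  by move=> /cone_size; rewrite size_rcons ltnn.
have P_cover : exists r : R, forall z, cone (addrY v) z -> r < mdist origin z ->
    (exists x, z = ptY v x) \/ exists w, cone (rcons (addrY v) w) z.
  pose w0 : W := if v is snocX v' a then wordx v' a else word0 _ _.
  exists (mdist origin (foot w0) + 1) => z vz rz.
  have [zv|] := cone_next vz; last by right.
  left; case: z vz rz zv => [v' x|v' x|w t] vz rz /=.
  - by move=> /addrXY.
  - by move=> /addrY_inj <-; exists x.
  - rewrite (_ : addrY v = rcons (stem w0) w0); last by rewrite /w0; case: (v).
    by move=> /rcons_inj[_ we]; move: rz; rewrite we ltNge edge_near.
apply/seteqP; split=> [xi [px nx]|_ [xi _ <-]].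
  exact: (ends_in_induced_map hY hXY (ptY_dist v) (fp_bicombing_ptY
    (coarsely_convex_bicombing hX) (coarsely_convex_bicombing hY) v) hphi
    S_cut (@origin_notin _) P_cover px nx).
exact: (induced_map_ends_in hXY hphi P_cut iP iS xi).
Qed.

(** The boundaries of X and Y embed as closed sets, as the cores of the two
    copies indexed by the empty word; conversely the nonempty cores are such boundaries. *)
Lemma covering_dim_le_free_product n :
  covering_dim_le bd n <->
  covering_dim_le (boundary EX CX gX eX) n /\ covering_dim_le (boundary EY CY gY eY) n.
Proof.
have bZ := boundary_base hXY (e := origin).
have geoX (v : wordX oX oY) :=
  fp_bicombing_ptX (coarsely_convex_bicombing hX) (coarsely_convex_bicombing hY) v.
have geoY (v : wordY oX oY) :=
  fp_bicombing_ptY (coarsely_convex_bicombing hX) (coarsely_convex_bicombing hY) v.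
split=> [dZ|[dX dY]].
  split.
    have [phi hphi] := phiX_ex (emptyX _ _).
    apply: (covering_dim_le_embedding (boundary_base hX) bZ
      (induced_map_near hX hXY (ptX_dist _) (geoX _) hphi)
      (induced_map_near_inv hX hXY (ptX_dist _) (geoX _) hphi) _ dZ).
    by rewrite -(core_addrX hphi); exact: core_cylinder_closed.
  have [phi hphi] := phiY_ex (emptyY _ _).
  apply: (covering_dim_le_embedding (boundary_base hY) bZ
    (induced_map_near hY hXY (ptY_dist _) (geoY _) hphi)
    (induced_map_near_inv hY hXY (ptY_dist _) (geoY _) hphi) _ dZ).
  by rewrite -(core_addrY hphi); exact: core_cylinder_closed.
apply: (covering_dim_le_tree bZ cylinder0 cylinder_open cylinder_rcons cylinder_disj
  _ cylinder_shrink cylinder_lim) => p.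
have [[xi px]|ne] := pselect (cylinder p !=set0).
  have [[v ->]|[v ->]] := cone_nonempty (cylinder_cone px).
    have [phi hphi] := phiX_ex v; rewrite (core_addrX hphi).
    exact: (rel_dim_le_embedding (boundary_base hX) bZ
      (induced_map_near hX hXY (ptX_dist _) (geoX _) hphi)
      (induced_map_near_inv hX hXY (ptX_dist _) (geoX _) hphi) dX).
  have [phi hphi] := phiY_ex v; rewrite (core_addrY hphi).
  exact: (rel_dim_le_embedding (boundary_base hY) bZ
    (induced_map_near hY hXY (ptY_dist _) (geoY _) hphi)
    (induced_map_near_inv hY hXY (ptY_dist _) (geoY _) hphi) dY).
move=> A _; exists (fun=> set0); split=> // [xi [px _]|xi].
  by case: ne; exists xi.
by apply: (@card_le_sub1 _ _ set0) => U [].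
Qed.

End BoundaryOfFreeProduct.

(** The intersection of two upward closed sets of integers starts at the larger
    of their minima. *)
Lemma ereal_inf_upclosed_and (R : realType) (P Q : nat -> Prop) :
  (forall n m, (n <= m)%N -> P n -> P m) -> (forall n m, (n <= m)%N -> Q n -> Q m) ->
  ereal_inf [set n%:R%:E | n in [set n | P n /\ Q n]] =
  maxe (ereal_inf [set n%:R%:E | n in P]) (ereal_inf [set n%:R%:E | n in Q]) :> \bar R.
Proof.
move=> Pm Qm; apply/le_anti/andP; split; last first.
  by rewrite ge_max; apply/andP; split; apply: ereal_inf_le_tmp => _ [n [Pn Qn] <-];
    exists n.
rewrite leNgt; apply/negP; rewrite gt_max => /andP[].
move=> /ereal_inf_lt[_ [n Pn <-] nlt] /ereal_inf_lt[_ [m Qm' <-] mlt].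
have : ((maxn n m)%:R%:E <
    ereal_inf [set n%:R%:E | n in [set n | P n /\ Q n]] :> \bar R)%E.
  by rewrite /maxn; case: ifP.
apply/negP; rewrite -leNgt; apply: ereal_inf_lbound; exists (maxn n m) => //.
by split; [apply: Pm Pn; rewrite leq_maxl|apply: Qm Qm'; rewrite leq_maxr].
Qed.

Theorem theorem1p4 (R : realType) (X Y : metricType R)
    (EX CX : R) (gX : X -> X -> R -> X) (EY CY : R) (gY : Y -> Y -> R -> Y)
    (NX : net X) (NY : net Y) (oX : net_pts NX) (oY : net_pts NY)
    (E C : R) (eX : X) (eY : Y) (e : free_product oX oY)
    (hX : coarsely_convex EX CX gX) (hY : coarsely_convex EY CY gY)
    (hoX : net_map oX = net_base NX) (hoY : net_map oY = net_base NY)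
    (hXY : coarsely_convex E C (fp_bicombing (oX := oX) (oY := oY) gX gY)) :
  covering_dim R (boundary E C (fp_bicombing gX gY) e) =
    maxe (covering_dim R (boundary EX CX gX eX))
         (covering_dim R (boundary EY CY gY eY)).
Proof.
rewrite /covering_dim -ereal_inf_upclosed_and; try exact: covering_dim_le_mono.
congr (ereal_inf (_ @` _)); apply/seteqP; split=> n /= h.
  apply/(covering_dim_le_free_product hX hY hXY).
  exact: covering_dim_le_base h.
apply: (covering_dim_le_base (e1 := origin (oX := oX) (oY := oY)) hXY).
exact: ((covering_dim_le_free_product hX hY hXY n).2 h).
Qed.
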